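(* Let $(X,\omega)$ be a $d$-dimensional tropical cycle. Then $X$ is irreducible if and only if $g := \gcd(\omega(\sigma) : \sigma\in X^{(d)}) = 1$ and $\dim V_X = 1$.
   Context: For a polyhedron $\sigma\subset\mathbb{R}^n$, $V_\sigma := \langle a-b : a,b\in\sigma\rangle$ and $\Lambda_\sigma := V_\sigma\cap\mathbb{Z}^n$. If $\tau$ is a codimension one face of the rational polyhedron $\sigma$ and $g$ is an integral linear form whose minimal locus on $\sigma$ is $\tau$, then $u_{\sigma/\tau}$ denotes the unique generator of $\Lambda_\sigma/\Lambda_\tau\cong\mathbb{Z}$ with $g(u_{\sigma/\tau})>0$. A tropical cycle $(X,\omega)$ is a pure rational $d$-dimensional polyhedral complex $X$ in $\mathbb{R}^n$ together with a weight function $\omega: X^{(d)}\to\mathbb{Z}$, where $X^{(k)}$ denotes the set of $k$-dimensional cells of $X$, such that for every $\tau\in X^{(d-1)}$, $\sum_{\sigma>\tau}\omega(\sigma)u_{\sigma/\tau}=0$ in $\mathbb{R}^n/V_\tau$ (balancing condition). The support $|X|$ is the union of all cells. Two tropical cycles are considered equivalent if they have the same support and there is a finer polyhedral structure on this support that respects both weight functions; a polyhedral structure $\mathcal{X}$ of $X$ is a specific choice of weighted complex representing $X$. A $d$-dimensional tropical cycle $X$ is called irreducible if any other $d$-dimensional cycle $Y$ with $|Y|\subseteq|X|$ is an integer multiple of $X$ (i.e. $Y=k\cdot X$ for some $k\in\mathbb{Z}$, where $k\cdot X$ is the cycle with weights $k\,\omega$). Let $\mathcal{X}$ be a polyhedral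 structure of $X$ with maximal cells $\sigma_1,\dots,\sigma_N$. Identify an integer vector $\omega\in\mathbb{Z}^N$ with the weight function $\sigma_i\mapsto\omega_i$, and put $\Lambda_{\mathcal{X}} := \{\omega\in\mathbb{Z}^N : (\mathcal{X},\omega)\text{ is balanced}\}$ (a lattice) and $V_{\mathcal{X}} := \Lambda_{\mathcal{X}}\otimes\mathbb{R}$. Up to isomorphism $V_{\mathcal{X}}$ does not depend on the chosen polyhedral structure, and $V_X$ (the weight space of $X$) denotes $V_{\mathcal{X}}$ for any polyhedral structure $\mathcal{X}$ of $X$.
   Formalization: Tropical cycles (X and every competitor Y) are taken to be nonempty with nonzero weight on every maximal cell; with zero weights allowed, a weight-0 segment inside a line of weight 1 would be a cycle that is not a multiple of the line, and the claim would fail. *)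

(* Defs.v *)
From HB Require Import structures.
From mathcomp Require Import all_boot all_order all_algebra.
From mathcomp Require Import finmap.
From mathcomp Require Import boolp classical_sets reals.

Set Implicit Arguments.
Unset Strict Implicit.
Unset Printing Implicit Defensive.

Import Order.TTheory GRing.Theory Num.Theory.

Local Open Scope classical_set_scope.
Local Open Scope ring_scope.

Lemma lspan_exists (K : fieldType) (vT : vectType K) (A : set vT) :
  exists U : {vspace vT},
    (forall v, A v -> v \in U) /\
    (forall W : {vspace vT}, (forall v, A v -> v \in W) -> (U <= W)%VS).
Proof.
pose P k := `[< exists U : {vspace vT},
                  (forall v, A v -> v \in U) /\ \dim U = k >].
have exP : exists k, P k.
  exists (\dim {:vT}); apply/asboolP; exists fullv.
  by split=> // v _; rewrite memvf.
case: (ex_minnP exP) => k /asboolP [U [AU dU]] kmin.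
exists U; split=> // W AW.
have AUW v : A v -> v \in (U :&: W)%VS by move=> Av; rewrite memv_cap AU ?AW.
have leU : (\dim U <= \dim (U :&: W))%N.
  by rewrite dU; apply: kmin; apply/asboolP; exists (U :&: W)%VS.
suff /eqP <- : (U :&: W == U)%VS by exact: capvSr.
by rewrite eqEdim capvSl.
Qed.

(* The linear span of an arbitrary set of vectors. *)
Definition lspan (K : fieldType) (vT : vectType K) (A : set vT) :
  {vspace vT} := projT1 (cid (lspan_exists A)).

Definition lform (R : realType) (n : nat) (g x : 'rV[R]_n) : R :=
  \sum_(i < n) g 0 i * x 0 i.

Definition integral_vec (R : realType) (n : nat) (v : 'rV[R]_n) : Prop :=
  forall i, v 0 i \is a Num.int.

(* As usual in tropical geometry, rationality constrains the slopes only: the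
   constant terms are arbitrary reals. *)
Definition rational_polyhedron (R : realType) (n : nat)
    (s : set 'rV[R]_n) : Prop :=
  exists m (A : 'I_m -> 'rV[R]_n) (b : 'I_m -> R),
    (forall i, integral_vec (A i)) /\
    s = [set x | forall i, b i <= lform (A i) x].

Definition minimal_locus (R : realType) (n : nat)
    (g : 'rV[R]_n) (s : set 'rV[R]_n) : set 'rV[R]_n :=
  [set x | s x /\ forall y, s y -> lform g x <= lform g y].

(* Faces are nonempty; [s] itself is a face of a nonempty [s], with g = 0. *)
Definition is_face (R : realType) (n : nat) (t s : set 'rV[R]_n) : Prop :=
  t !=set0 /\ exists g, t = minimal_locus g s.

Definition direction (R : realType) (n : nat) (s : set 'rV[R]_n) :
    {vspace 'rV[R]_n} :=
  lspan [set v | exists a b, [/\ s a, s b & v = a - b]].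

Definition pdim (R : realType) (n : nat) (s : set 'rV[R]_n) : nat :=
  \dim (direction s).

Definition lattice (R : realType) (n : nat) (s : set 'rV[R]_n) :
    set 'rV[R]_n :=
  [set v | v \in direction s /\ integral_vec v].

(* [u] represents the generator of [lattice s / lattice t] which is positive on
   an integral form [g] cutting out [t]. *)
Definition is_normal (R : realType) (n : nat) (s t : set 'rV[R]_n)
    (u : 'rV[R]_n) : Prop :=
  [/\ lattice s u,
      forall v, lattice s v -> exists k : int, lattice t (v - u *~ k)
    & exists g, [/\ integral_vec g, minimal_locus g s = t & 0 < lform g u]].

(* A representative, modulo [lattice t], of the lattice normal vector. *)
Definition lattice_normal (R : realType) (n : nat) (s t : set 'rV[R]_n) :
  'rV[R]_n := xget 0 [set u | is_normal s t u].

Record pcomplex (R : realType) (n : nat) := PComplex {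
  cells :> {fset (set 'rV[R]_n)} ;
  cells_polyhedron : forall s, s \in cells -> rational_polyhedron s ;
  cells_neq0 : forall s, s \in cells -> s !=set0 ;
  cells_face : forall s t, s \in cells -> is_face t s -> t \in cells ;
  cells_inter : forall s t, s \in cells -> t \in cells ->
    (s `&` t) !=set0 -> is_face (s `&` t) s /\ is_face (s `&` t) t }.

Definition cells_dim (R : realType) (n : nat) (X : pcomplex R n) (k : nat) :
    {fset (set 'rV[R]_n)} :=
  [fset s in cells X | pdim s == k]%fset.

Definition support (R : realType) (n : nat) (X : pcomplex R n) :
    set 'rV[R]_n :=
  [set x | exists2 s, s \in cells X & s x].

(* Pure of dimension [d]; in particular the complex is not empty. *)
Definition pure (R : realType) (n d : nat) (X : pcomplex R n) : Prop :=
  (exists s, s \in cells X) /\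
  (forall t, t \in cells X -> exists2 s, s \in cells_dim X d & is_face t s).

Definition weight (R : realType) (n d : nat) (X : pcomplex R n) : Type :=
  {ffun cells_dim X d -> int}.

Definition balanced (R : realType) (n d : nat) (X : pcomplex R n)
    (w : weight d X) : Prop :=
  forall t, t \in cells X -> (pdim t).+1 = d ->
    \sum_(s : cells_dim X d | `[< is_face t (val s) >])
      lattice_normal (val s) t *~ w s \in direction t.

Record wcomplex (R : realType) (n d : nat) := WComplex {
  wcx :> pcomplex R n ;
  wcx_pure : pure d wcx ;
  wt : weight d wcx }.

(* No cell has weight zero.  Otherwise a ray of weight 0 would be a cycle
   contained in any line containing it, with a different support from all the
   multiples of the line. *)
Record tropical_cycle (R : realType) (n d : nat) := TropicalCycle {
  tc_wcx :> wcomplex R n d ;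
  tc_neq0 : forall s, wt tc_wcx s != 0 ;
  tc_balanced : balanced (wt tc_wcx) }.

(* [Z] is finer than [X], on the same support, with compatible weights. *)
Definition refines (R : realType) (n d : nat) (Z X : wcomplex R n d) : Prop :=
  [/\ support Z = support X,
      forall z, z \in cells Z -> exists2 s, s \in cells X & z `<=` s
    & forall (z : cells_dim Z d) (s : cells_dim X d),
        val z `<=` val s -> wt Z z = wt X s].

Definition cycle_eq (R : realType) (n d : nat) (X Y : wcomplex R n d) : Prop :=
  support X = support Y /\ exists Z, refines Z X /\ refines Z Y.

Definition scale_wcx (R : realType) (n d : nat) (k : int)
    (X : wcomplex R n d) : wcomplex R n d :=
  @WComplex R n d X (wcx_pure X) [ffun s => k * wt X s].

Definition irreducible_cycle (R : realType) (n d : nat)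
    (X : tropical_cycle R n d) : Prop :=
  forall Y : tropical_cycle R n d, support Y `<=` support X ->
    exists k : int, cycle_eq Y (scale_wcx k X).

Definition weight_lattice (R : realType) (n d : nat) (X : pcomplex R n) :
    set (weight d X) :=
  [set w | balanced w].

(* Since the weight lattice L is a subgroup of Z^N, the tensor product of L
   with the reals is identified with the real span of L in R^N. *)
Definition weight_space (R : realType) (n d : nat) (X : pcomplex R n) :
    {vspace {ffun cells_dim X d -> R^o}} :=
  lspan [set v | exists2 w, @weight_lattice R n d X w
                          & v = [ffun s => (w s)%:~R : R^o]].

Definition weight_gcd (R : realType) (n d : nat) (X : wcomplex R n d) : int :=
  \big[gcdz/0]_(s : cells_dim X d) wt X s.

(* Main.v *)
Require Import Defs.
From mathcomp Require Import all_boot all_order all_algebra.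
From mathcomp Require Import finmap.
From mathcomp Require Import boolp classical_sets reals.
From mathcomp Require Import ring lra zify.

(** Both conditions say that every balanced weight on the maximal cells of [X]
    is an integer multiple of [wt X], so the content lies in comparing the cycles
    inside the support of [X] with the weights on the one complex [X].

    If [X] is irreducible, cycles carried by the complex [X] itself suffice.
    Dividing [wt X] by its gcd gives a cycle, so the gcd is 1
    ([irreducible_gcd]).  A balanced weight [w] need not be a cycle, since it may
    vanish somewhere, but [w + m * wt X] vanishes nowhere for large [m]; hence [w]
    is a multiple of [wt X] and the weight space is a line ([irreducible_dim]).

    Conversely, let [Y] be a cycle of the same dimension with support inside that
    of [X].  The main point is that [Y] induces a balanced weight on [X],
    [transfer X Y], although the two polyhedral structures are unrelated.

    - Locally: at a point [p] whose star in [Y] is invariant under a subspace [L]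
      of codimension one, that star is a union of half-spaces [L + R_{>=0} u].
      Counted with weights, the primitive vectors [u] sum to zero modulo [L],
      whatever the face of [Y] through [p] may be ([local_balance]).
    - Inside a maximal cell [s] of [X]: the support of [Y] cannot end and its
      weight cannot change.  Join two general points of [s] by a segment that
      avoids the faces of [Y] of codimension at least two.  Wherever it meets a
      face of codimension one, local balancing for the two half-spaces of the span
      of [s] lets it go on in a cell of the same weight ([cross], [connect]).
      So if [Y] meets [s] in full dimension, it covers [s] with a constant weight
      ([overlap_covered], [overlap_weight]).
    - Across a facet [r] of [X]: local balancing of [Y] at a general point of [r]
      is the balancing condition for the induced weight ([transfer_balanced]).

    When the weight space is a line and the gcd is 1, the induced weight is an
    integer multiple [k * wt X] ([dim1_proportional]).  It is not zero, so it
    vanishes nowhere, [Y] covers [X], and the intersections of cells of [X] and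
    [Y] form a common refinement of [Y] and [k * X] ([cycle_eqP]).

    General points exist because a convex set is not a finite union of sets of
    smaller dimension ([generic_near]).  Lattice normal vectors exist because the
    direction of a rational polyhedron is spanned by integral vectors
    ([direction_rational], [normal_exists]). *)

Set Implicit Arguments.
Unset Strict Implicit.
Unset Printing Implicit Defensive.

Import Order.TTheory GRing.Theory Num.Theory.

Local Open Scope classical_set_scope.
Local Open Scope ring_scope.

(** * Linear span of a set of vectors *)

Section Span.
Variables (K : fieldType) (vT : vectType K).
Implicit Types (A B : set vT) (W : {vspace vT}).

Lemma mem_lspan A v : A v -> v \in lspan A.
Proof. by move=> Av; rewrite /lspan; case: cid => U [/= AU _]; exact: AU. Qed.

Lemma lspan_sub A W : (forall v, A v -> v \in W) -> (lspan A <= W)%VS.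
Proof. by move=> AW; rewrite /lspan; case: cid => U [/= _]; exact. Qed.

(** A set closed under linear combinations contains the span of its subsets: a
    subspace of maximal dimension among those contained in [S] is all of [S]. *)
Lemma lspan_linear A (S : set vT) : (forall v, A v -> S v) -> S 0 ->
  (forall (c : K) v, S v -> S (c *: v)) -> (forall v w, S v -> S w -> S (v + w)) ->
  forall v, v \in lspan A -> S v.
Proof.
move=> AS S0 SZ SD.
pose P k := `[< exists W, (forall v, v \in W -> S v) /\ \dim W = k >].
have exP : exists k, P k.
  exists 0; apply/asboolP; exists 0%VS; rewrite dimv0; split=> // v.
  by rewrite memv0 => /eqP ->.
have ubP k : P k -> (k <= \dim {:vT})%N.
  by move=> /asboolP[W [_ <-]]; apply: dimvS; exact: subvf.
case: (ex_maxnP exP ubP) => k /asboolP[W [WS dW]] kmax v vA.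
have SW w : S w -> w \in W.
  move=> Sw; have : P (\dim (W + <[w]>)%VS).
    apply/asboolP; exists (W + <[w]>)%VS; split=> // x.
    move=> /memv_addP[a aW [b /vlineP[c ->] ->]].
    by apply: SD; [exact: WS | exact: SZ].
  move=> /kmax; rewrite -dW => le_dim.
  have /eqP -> : (W == W + <[w]>)%VS by rewrite eqEdim addvSl.
  by rewrite memvE addvSr.
by apply: WS; apply: (subvP (lspan_sub _)) vA => w /AS /SW.
Qed.

End Span.

(** * Directions and linear forms *)

Section Affine.
Variables (R : realType) (n : nat).
Implicit Types (C D : set 'rV[R]_n) (p q v : 'rV[R]_n) (W : {vspace 'rV[R]_n}).

Lemma direction_mem C p q : C p -> C q -> p - q \in direction C.
Proof. by move=> Cp Cq; apply: mem_lspan; exists p, q. Qed.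

Lemma direction_sub C p W : C p -> (forall x, C x -> x - p \in W) ->
  (direction C <= W)%VS.
Proof.
move=> Cp CW; apply: lspan_sub => v [a [b [Ca Cb ->]]].
by rewrite -(subrKA p) memvD ?CW// -opprB memvN CW.
Qed.

Lemma directionS C D : C `<=` D -> (direction C <= direction D)%VS.
Proof.
move=> CD; apply: lspan_sub => v [a [b [Ca Cb ->]]].
by apply: direction_mem; exact: CD.
Qed.

Lemma pdimS C D : C `<=` D -> (pdim C <= pdim D)%N.
Proof. by move=> CD; apply/dimvS/directionS. Qed.

Lemma lformDr g v w : lform g (v + w) = lform g v + lform g w :> R.
Proof.
by rewrite /lform -big_split; apply: eq_bigr => i _; rewrite mxE mulrDr.
Qed.

Lemma lformZr g c v : lform g (c *: v) = c * lform g v :> R.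
Proof.
by rewrite /lform mulr_sumr; apply: eq_bigr => i _; rewrite mxE mulrCA.
Qed.

Lemma lformNr g v : lform g (- v) = - lform g v :> R.
Proof. by rewrite -scaleN1r lformZr mulN1r. Qed.

Lemma lformBr g v w : lform g (v - w) = lform g v - lform g w :> R.
Proof. by rewrite lformDr lformNr. Qed.

Lemma lform0r (g : 'rV[R]_n) : lform g 0 = 0 :> R.
Proof. by rewrite -[0](scale0r 0) lformZr mul0r. Qed.

Lemma lform_suml (I : finType) (P : pred I) (g : I -> 'rV[R]_n) v :
  lform (\sum_(i | P i) g i) v = \sum_(i | P i) lform (g i) v.
Proof.
rewrite /lform exchange_big; apply: eq_bigr => i _.
by rewrite summxE mulr_suml.
Qed.

Lemma lform_sumr (I : finType) (P : pred I) g (v : I -> 'rV[R]_n) :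
  lform g (\sum_(i | P i) v i) = \sum_(i | P i) lform g (v i).
Proof. exact: (big_morph _ (lformDr g) (lform0r g)). Qed.

Lemma lformMz g v (k : int) : lform g (v *~ k) = lform g v *~ k.
Proof. by rewrite -scaler_int lformZr mulrzl. Qed.

Lemma lform_lspan_eq0 g (A : set 'rV[R]_n) v :
  (forall a, A a -> lform g a = 0) -> v \in lspan A -> lform g v = 0.
Proof.
move=> gA; apply: (@lspan_linear _ _ A [set v | lform g v = 0]) => //=.
- exact: lform0r.
- by move=> c w; rewrite lformZr => ->; rewrite mulr0.
- by move=> a b; rewrite lformDr => -> ->; rewrite addr0.
Qed.

Definition convex C := forall x y t, C x -> C y -> 0 <= t -> t <= 1 ->
  C (x + t *: (y - x)).

Lemma convexI C D : convex C -> convex D -> convex (C `&` D).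
Proof. by move=> cC cD x y t [? ?] [? ?] *; split; [exact: cC|exact: cD]. Qed.

End Affine.

(** * Properties of all small positive numbers *)

Section Small.
Variable R : realType.

(** Germs at 0 from the right; closed under finite conjunction
    ([smallI], [small_all]), which is how all open conditions are combined. *)
Definition small (Q : R -> Prop) :=
  exists2 e : R, 0 < e & forall t, 0 < t -> t <= e -> Q t.

Lemma smallW (Q Q' : R -> Prop) : (forall t, 0 < t -> Q t -> Q' t) ->
  small Q -> small Q'.
Proof. by move=> QQ' [e e0 He]; exists e => // t t0 te; apply/QQ'/He. Qed.

Lemma smallT (Q : R -> Prop) : (forall t, 0 < t -> Q t) -> small Q.
Proof. by move=> HQ; exists 1 => // t t0 _; exact: HQ. Qed.

Lemma smallI (Q Q' : R -> Prop) : small Q -> small Q' ->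
  small (fun t => Q t /\ Q' t).
Proof.
move=> [e e0 He] [e' e'0 He']; exists (Num.min e e').
  by rewrite lt_min e0.
by move=> t t0; rewrite le_min => /andP[te te']; split; [exact: He|exact: He'].
Qed.

Lemma small_ex (Q : R -> Prop) (e : R) : 0 < e -> small Q ->
  exists t, [/\ 0 < t, t <= e & Q t].
Proof.
move=> e0 [f f0 Hf]; exists (Num.min e f); split.
- by rewrite lt_min e0.
- by rewrite ge_min lexx.
- by apply: Hf; rewrite ?lt_min ?e0// ge_min lexx orbT.
Qed.

Lemma small_all (T : eqType) (l : seq T) (Q : T -> R -> Prop) :
  (forall i, i \in l -> small (Q i)) ->
  small (fun t => forall i, i \in l -> Q i t).
Proof.
elim: l => [|a l IH] Hl; first exact: smallT.
have Ha := Hl a (mem_head _ _).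
have := IH (fun i il => Hl i (mem_behead (s := a :: l) il)).
move=> /(smallI Ha); apply: smallW => t _ [Qa Ql] i.
by rewrite inE => /orP[/eqP ->|/Ql].
Qed.

Lemma small_affine_gt0 (a b : R) : 0 < a -> small (fun t => 0 < a + t * b).
Proof.
move=> a0; exists (a / (1 + `|b|) / 2).
  by rewrite !divr_gt0// ltr_pwDl.
have b0 : 0 < 1 + `|b| by rewrite ltr_pwDl.
move=> t t0; rewrite -mulrA -invfM ler_pdivlMr ?mulr_gt0// => te.
have : - `|b| <= b by rewrite lerNl -normrN ler_norm.
by nra.
Qed.

End Small.

(** * General points of a convex set *)

Section Generic.
Variables (R : realType) (n : nat).
Implicit Types (C D : set 'rV[R]_n) (p q v : 'rV[R]_n) (W : {vspace 'rV[R]_n}).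

(** A line not contained in [W] meets it at most once. *)
Lemma small_avoid W a b : a \notin W \/ b \notin W ->
  small (fun t => a + t *: b \notin W).
Proof.
move=> ab; have [[t0 t0_gt0 t0W]|noT] :=
  pselect (exists2 t, 0 < t & a + t *: b \in W); last first.
  by exists 1 => // t tgt0 _; apply/negP => tW; apply: noT; exists t.
exists (t0 / 2); first by rewrite divr_gt0.
move=> t tgt0 tle; apply/negP => tW.
have : (t0 - t) *: b \in W.
  have -> : (t0 - t) *: b = (a + t0 *: b) - (a + t *: b).
    by rewrite opprD addrACA subrr add0r scalerBl.
  exact: memvB.
have t0t : t0 - t != 0 by rewrite subr_eq0; apply/negP => /eqP; lra.
move=> bW; have {}bW : b \in W.
  by rewrite -[b](scalerK t0t) memvZ.
case: ab => /negP; apply => //.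
have -> : a = (a + t *: b) - t *: b by rewrite addrK.
by rewrite memvB// memvZ.
Qed.

(** Induction on [l]: a point that avoids the previous subspaces keeps doing so
    when it is moved slightly towards a point [y] outside [q + W j]. *)
Lemma avoid_subspaces (T : eqType) (l : seq T) (W : T -> {vspace 'rV[R]_n})
    C q : convex C -> C q ->
  (forall j, j \in l -> (\dim (W j) < pdim C)%N) ->
  exists2 x, C x & forall j, j \in l -> x - q \notin W j.
Proof.
move=> cC Cq; elim: l => [|j l IH] dimW; first by exists q.
have [i il|x Cx xW] := IH; first by apply: dimW; rewrite inE il orbT.
have [y Cy yW] : exists2 y, C y & y - q \notin W j.
  apply: contrapT => no; have := dimW j (mem_head _ _).
  rewrite ltnNge => /negP; apply; apply: dimvS.
  apply: (direction_sub Cq) => z Cz.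
  by apply: contrapT => /negP zW; apply: no; exists z.
have [xj|xj] := boolP (x - q \in W j); last first.
  by exists x => // i; rewrite inE => /orP[/eqP ->|/xW].
have sm : small (fun t => forall i, i \in j :: l ->
    x - q + t *: (y - x) \notin W i).
  apply: small_all => i; rewrite inE => /orP[/eqP ->|il].
    apply: small_avoid; right; apply: contra yW => yxW.
    by rewrite -(subrKA x) memvD.
  by apply: small_avoid; left; exact: xW.
have [t [t0 t1 tW]] := small_ex ltr01 sm.
exists (x + t *: (y - x)); first by apply: cC => //; exact: ltW.
by move=> i /tW; rewrite addrAC.
Qed.

(** A convex set is not covered by finitely many sets of smaller dimension, even
    near one of its points [q]: each thin [D j] lies in a translate of its
    direction, which a segment leaving [q] in a general direction meets at most
    once.  The conclusion is phrased so that the sets that are not thin may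
    belong to the list as well. *)
Lemma generic_near (T : eqType) (l : seq T) (D : T -> set 'rV[R]_n) C q :
  convex C -> C q ->
  exists2 x, C x & small (fun t => forall j, j \in l ->
    D j (q + t *: (x - q)) -> (pdim C <= pdim (D j))%N).
Proof.
move=> cC Cq.
pose l' := [seq j <- l | (pdim (D j) < pdim C)%N].
have [j|x Cx xW] := @avoid_subspaces T l' (fun j => direction (D j)) C q cC Cq.
  by rewrite mem_filter => /andP[].
exists x => //; apply: small_all => j jl.
have [le|lt] := leqP (pdim C) (pdim (D j)); first exact: smallT.
have /xW xWj : j \in l' by rewrite mem_filter lt.
have [[a Da]|noa] := pselect (exists a, D j a); last first.
  by apply: smallT => t _ Dt; case: noa; eexists; exact: Dt.
have := @small_avoid (direction (D j)) (q - a) (x - q) (or_intror xWj).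
apply: smallW => t _ /negP tW Dt; case: tW.
by rewrite addrAC; exact: direction_mem.
Qed.

Lemma generic_point (T : eqType) (l : seq T) (D : T -> set 'rV[R]_n) C :
  convex C -> C !=set0 ->
  exists2 x, C x & forall j, j \in l -> D j x -> (pdim C <= pdim (D j))%N.
Proof.
move=> cC [q Cq]; have [x Cx sm] := generic_near l D cC Cq.
have [t [t0 t1 tD]] := small_ex ltr01 sm.
by exists (q + t *: (x - q)) => //; apply: cC => //; exact: ltW.
Qed.

End Generic.

(** * Tangent cones and minimal faces *)

Section Cone.
Variables (R : realType) (n : nat).
Implicit Types (C D : set 'rV[R]_n) (p q v : 'rV[R]_n) (W : {vspace 'rV[R]_n}).

(** For a convex [C] containing [p], the cone of directions in which [C]
    extends from [p]. *)
Definition tcone C p : set 'rV[R]_n :=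
  [set v | exists2 e : R, 0 < e & C (p + e *: v)].

Lemma tcone_small C p v : convex C -> C p -> tcone C p v ->
  small (fun t => C (p + t *: v)).
Proof.
move=> cC Cp [e e0 Ce]; exists e => // t t0 te.
have := cC _ _ (t / e) Cp Ce; rewrite [p + _ - p]addrC addKr scalerA divfK ?gt_eqF//.
by apply; [rewrite divr_ge0// ltW | rewrite ler_pdivrMr// mul1r].
Qed.

Lemma small_tcone C p v : small (fun t => C (p + t *: v)) -> tcone C p v.
Proof. by move=> /(small_ex ltr01)[t [t0 _ Ct]]; exists t. Qed.

Lemma tconeS C D p v : C `<=` D -> tcone C p v -> tcone D p v.
Proof. by move=> CD [e e0 /CD]; exists e. Qed.

Lemma tcone_sub C p q : C q -> tcone C p (q - p).
Proof. by move=> Cq; exists 1 => //; rewrite scale1r addrC subrK. Qed.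

Lemma tcone0 C p : C p -> tcone C p 0.
Proof. by move=> Cp; exists 1 => //; rewrite scaler0 addr0. Qed.

Lemma tconeZ C p c v : C p -> 0 <= c -> tcone C p v -> tcone C p (c *: v).
Proof.
rewrite le_eqVlt => Cp /predU1P[<- _|c0 [e e0 Ce]].
  by rewrite scale0r; exact: tcone0.
by exists (e / c); rewrite ?divr_gt0// scalerA divfK// gt_eqF.
Qed.

Lemma tconeD C p v w : convex C -> C p -> tcone C p v -> tcone C p w ->
  tcone C p (v + w).
Proof.
move=> cC Cp /(tcone_small cC Cp) sv /(tcone_small cC Cp) sw.
have [t [t0 _ [Cv Cw]]] := small_ex ltr01 (smallI sv sw).
exists (t / 2); first by rewrite divr_gt0.
have := cC _ _ (1/2) Cv Cw.
have -> : p + t *: v + (1 / 2) *: (p + t *: w - (p + t *: v))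
          = p + (t / 2) *: (v + w).
  by apply/rowP => i; rewrite !mxE; field.
by apply; lra.
Qed.

Lemma tconeI C D p v : convex C -> convex D -> C p -> D p ->
  tcone C p v -> tcone D p v -> tcone (C `&` D) p v.
Proof.
move=> cC cD Cp Dp /(tcone_small cC Cp) sC /(tcone_small cD Dp) sD.
exact/small_tcone/smallI.
Qed.

Lemma tcone_direction C p v : C p -> tcone C p v -> v \in direction C.
Proof.
move=> Cp [e e0 Ce]; have e_neq0 : e != 0 by rewrite gt_eqF.
rewrite -[v](scalerK e_neq0) memvZ//.
by have := direction_mem Ce Cp; rewrite [p + _]addrC addrK.
Qed.

(** [p] lies in the relative interior of [C]. *)
Definition relint C p := C p /\ forall v, v \in direction C -> tcone C p v.

(** A convex cone that is symmetric is a subspace. *)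
Lemma relintP C p : convex C -> C p ->
  (forall x, C x -> tcone C p (p - x)) -> relint C p.
Proof.
move=> cC Cp Copp; split=> // v; have tN w : tcone C p w -> tcone C p (- w).
  move=> [e e0 Ce]; have := tconeZ Cp (ltW _) (Copp _ Ce).
  move=> /(_ e^-1); rewrite invr_gt0 => /(_ e0).
  by rewrite opprD addNKr scalerN scalerK ?gt_eqF.
apply: lspan_linear.
- move=> _ [a [b [Ca Cb ->]]]; rewrite -(subrKA p); apply: tconeD => //.
    exact: tcone_sub.
  exact: Copp.
- exact: tcone0.
- move=> c w tw; have [c0|c0] := leP 0 c; first exact: tconeZ.
  by rewrite -[c]opprK scaleNr; apply/tN/tconeZ => //; rewrite oppr_ge0 ltW.
- by move=> ? ?; exact: tconeD.
Qed.

(** For a polyhedron this is the smallest face through [p]: the points [x] such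
    that the segment from [x] to [p] can be prolonged beyond [p] inside [C].
    This description does not refer to the inequalities defining [C]. *)
Definition min_face C p : set 'rV[R]_n := [set x | C x /\ tcone C p (p - x)].

Lemma min_face_self C p : C p -> min_face C p p.
Proof. by move=> Cp; split=> //; rewrite subrr; exact: tcone0. Qed.

Lemma min_face_subset C p : min_face C p `<=` C.
Proof. by move=> x []. Qed.

(** A linear form that is minimal at [p] is constant along a segment that can be
    prolonged beyond [p]. *)
Lemma min_face_sub_minimal C p g : minimal_locus g C p ->
  min_face C p `<=` minimal_locus g C.
Proof.
move=> [Cp pmin] x [Cx [e e0 Ce]]; split=> // y Cy.
apply: le_trans (pmin y Cy); have := pmin _ Ce.
rewrite lformDr lformZr lformBr => h.
have : 0 <= e * (lform g p - lform g x) by lra.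
by rewrite pmulr_rge0// subr_ge0.
Qed.

Lemma mfaceI C D p : convex C -> convex D -> C p -> D p ->
  min_face (C `&` D) p = min_face C p `&` min_face D p.
Proof.
move=> cC cD Cp Dp; apply/seteqP; split=> x.
  move=> [[Cx Dx] h]; split; split=> //; apply: tconeS h.
    exact: subIsetl.
  exact: subIsetr.
by move=> [[Cx hC] [Dx hD]]; split=> //; exact: tconeI.
Qed.

Lemma convex_min_face C p : convex C -> C p -> convex (min_face C p).
Proof.
move=> cC Cp x y t [Cx hx] [Cy hy] t0 t1; split; first exact: cC.
have -> : p - (x + t *: (y - x)) = (1 - t) *: (p - x) + t *: (p - y).
  by apply/rowP => i; rewrite !mxE; ring.
by apply: tconeD => //; apply: tconeZ => //; rewrite subr_ge0.
Qed.

Lemma relint_min_face C p : convex C -> C p -> relint (min_face C p) p.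
Proof.
move=> cC Cp; apply: relintP; [exact: convex_min_face|exact: min_face_self|].
move=> x [Cx [e e0 Ce]]; exists e => //; split=> //.
rewrite opprD addNKr -scalerN opprB.
by apply: tconeZ (ltW e0) _ => //; exact: tcone_sub.
Qed.

Lemma min_face_relint C p : relint C p -> min_face C p = C.
Proof.
move=> [Cp pin]; apply/seteqP; split=> [x []//|x Cx]; split=> //.
by apply: pin; exact: direction_mem.
Qed.

Lemma face_subset C D : is_face D C -> D `<=` C.
Proof. by move=> [_ [g ->]] x []. Qed.

Lemma is_face_refl C : C !=set0 -> is_face C C.
Proof.
move=> C0; split=> //; exists 0; apply/seteqP; split=> x; last by case.
move=> Cx; split=> // y _.
by rewrite /lform; apply: ler_sum => i _; rewrite !mxE !mul0r.
Qed.

(** The form cutting out [D] vanishes on the direction of [D]; if this is the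
    direction of [C], the form is constant on [C]. *)
Lemma face_eq C D : is_face D C -> (pdim C <= pdim D)%N -> D = C.
Proof.
move=> DC dimDC; have sDC := face_subset DC; move: DC => [[p Dp] [g Dg]].
apply/seteqP; split=> // x Cx.
have /eqP eqV : (direction D == direction C)%VS by rewrite eqEdim directionS.
have g0 : lform g (x - p) = 0.
  have : x - p \in direction D by rewrite eqV; apply: direction_mem => //; exact: sDC.
  apply: lform_lspan_eq0 => _ [a [b [+ + ->]]]; rewrite Dg lformBr.
  move=> [Ca amin] [Cb bmin].
  by apply/eqP; rewrite subr_eq0 eq_le amin// bmin.
move: Dp; rewrite Dg => -[Cp pmin]; split=> // y Cy.
by move: g0; rewrite lformBr => /eqP; rewrite subr_eq0 => /eqP ->; exact: pmin.
Qed.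

Lemma convex_minimal C g : convex C -> convex (minimal_locus g C).
Proof.
move=> cC x y t [Cx xm] [Cy ym] t0 t1; split=> [|z Cz]; first exact: cC.
have hx := xm _ Cz; have hy := ym _ Cz.
rewrite lformDr lformZr lformBr.
have h1 : t * lform g y <= t * lform g z by apply: ler_wpM2l.
have h2 : (1 - t) * lform g x <= (1 - t) * lform g z by rewrite ler_wpM2l// subr_ge0.
lra.
Qed.

End Cone.

(** * Rational polyhedra *)

Section Polyhedra.
Variables (R : realType) (n : nat).
Implicit Types (C D P : set 'rV[R]_n) (p q v : 'rV[R]_n) (W : {vspace 'rV[R]_n}).

Lemma convex_inequalities (m : nat) (A : 'I_m -> 'rV[R]_n) (b : 'I_m -> R) :
  convex [set x | forall i, b i <= lform (A i) x].
Proof.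
move=> x y t /= hx hy t0 t1 i; rewrite lformDr lformZr lformBr.
have h1 : t * b i <= t * lform (A i) y by apply: ler_wpM2l.
have h2 : (1 - t) * b i <= (1 - t) * lform (A i) x.
  by rewrite ler_wpM2l// subr_ge0.
lra.
Qed.

Lemma polyhedron_convex P : rational_polyhedron P -> convex P.
Proof. by move=> [m [A [b [_ ->]]]]; exact: convex_inequalities. Qed.

(** Polyhedra are closed: a violated inequality stays violated nearby. *)
Lemma polyhedron_avoid P p v : rational_polyhedron P -> ~ P p ->
  small (fun t => ~ P (p + t *: v)).
Proof.
move=> [m [A [b [_ ->]]]] /= /existsNP[i /negP]; rewrite -ltNge => hi.
have := @small_affine_gt0 _ (b i - lform (A i) p) (- lform (A i) v).
rewrite subr_gt0 => /(_ hi); apply: smallW => t t0 h /(_ i).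
by rewrite lformDr lformZr; lra.
Qed.

Lemma polyhedronI P Q : rational_polyhedron P -> rational_polyhedron Q ->
  rational_polyhedron (P `&` Q).
Proof.
move=> [m1 [A1 [b1 [i1 ->]]]] [m2 [A2 [b2 [i2 ->]]]].
exists (m1 + m2)%N, (fun i => match split i with inl j => A1 j | inr j => A2 j end),
  (fun i => match split i with inl j => b1 j | inr j => b2 j end); split.
  by move=> i; case: (split i).
apply/seteqP; split=> x /=.
  by move=> [h1 h2] i; case: (split i).
move=> h; split=> i.
  by have := h (unsplit (inl i)); rewrite unsplitK.
by have := h (unsplit (inr i)); rewrite unsplitK.
Qed.

Lemma integral_vec_sum (I : finType) (Q : pred I) (v : I -> 'rV[R]_n) :
  (forall i, integral_vec (v i)) -> integral_vec (\sum_(i | Q i) v i).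
Proof. by move=> iv j; rewrite summxE rpred_sum// => i _; exact: iv. Qed.

Section Active.
Variables (m : nat) (A : 'I_m -> 'rV[R]_n) (b : 'I_m -> R).
Let P := [set x | forall i, b i <= lform (A i) x].
Definition active p : {set 'I_m} := [set i | lform (A i) p == b i].

Lemma tcone_active p v : P p ->
  (forall i, i \in active p -> 0 <= lform (A i) v) -> tcone P p v.
Proof.
move=> Pp vpos; apply: small_tcone.
have : small (fun t => forall i, i \in enum 'I_m ->
    b i <= lform (A i) (p + t *: v)).
  apply: small_all => i _; have [ia|ia] := boolP (i \in active p).
    apply: smallT => t t0; rewrite lformDr lformZr.
    by rewrite (le_trans (Pp i))// lerDl mulr_ge0 ?vpos// ltW.
  have : 0 < lform (A i) p - b i.
    by rewrite subr_gt0 lt_neqAle Pp andbT eq_sym; move: ia; rewrite inE.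
  move=> /(@small_affine_gt0 _ _ (lform (A i) v)); apply: smallW => t t0.
  by rewrite lformDr lformZr; lra.
by apply: smallW => t t0 h i; apply: h; rewrite mem_enum.
Qed.

(** Minimal faces in terms of inequalities: those that are equalities at [p] must
    be equalities at [x], and the others leave room to move. *)
Lemma min_face_active p : P p ->
  min_face P p = [set x | P x /\ active p \subset active x].
Proof.
move=> Pp; apply/seteqP; split=> x [Px].
  move=> [e e0 Pe]; split=> //; apply/fintype.subsetP => i; rewrite !inE => /eqP pi.
  have := Pe i; rewrite lformDr lformZr lformBr pi => h.
  have : 0 <= e * (b i - lform (A i) x) by lra.
  by rewrite pmulr_rge0// subr_ge0 eq_le Px andbT.
move=> sub; split=> //; apply: tcone_active => // i ia.
have := fintype.subsetP sub i ia; move: ia; rewrite !inE => /eqP pi /eqP xi.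
by rewrite lformBr pi xi subrr.
Qed.

(** The sum of the active constraints attains its minimum exactly where they are
    all equalities.  It is integral when the constraints are. *)
Lemma min_face_minimal_locus p : P p ->
  min_face P p = minimal_locus (\sum_(i in active p) A i) P.
Proof.
move=> Pp; rewrite min_face_active//.
have val y : lform (\sum_(i in active p) A i) y =
    \sum_(i in active p) lform (A i) y by exact: lform_suml.
have valp : \sum_(i in active p) lform (A i) p = \sum_(i in active p) b i.
  by apply: eq_bigr => i; rewrite inE => /eqP.
apply/seteqP; split=> x [Px].
  move=> sub; split=> // y Py; rewrite !val; apply: ler_sum => i ia.
  by have := fintype.subsetP sub i ia; rewrite inE => /eqP ->; exact: Py.
move=> /(_ p Pp); rewrite !val valp => le; split=> //.
have /eqP : \sum_(i in active p) (lform (A i) x - b i) = 0.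
  rewrite sumrB; apply/eqP; rewrite eq_le subr_le0 le subr_ge0.
  by apply: ler_sum => i _; exact: Px.
rewrite psumr_eq0 => [/allP h|i _]; last by rewrite subr_ge0; exact: Px.
apply/fintype.subsetP => i ia; rewrite inE -subr_eq0.
by have := h i (mem_index_enum _); rewrite ia.
Qed.

(** A real linear form cuts out no other faces than the minimal faces of points:
    take [p] in the face with as few active constraints as possible.  The
    constraints active at the midpoint of [p] and [x] are those active at both,
    so by minimality every [x] in the face satisfies those of [p]. *)
Lemma minimal_locus_min_face g : minimal_locus g P !=set0 ->
  exists2 p, minimal_locus g P p & minimal_locus g P = min_face P p.
Proof.
move=> [p0 Fp0].
pose Q k := `[< exists2 p, minimal_locus g P p & #|active p| = k >].
have exQ : exists k, Q k by exists #|active p0|; apply/asboolP; exists p0.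
case: (ex_minnP exQ) => k /asboolP[p Fp pk] kmin.
exists p => //; apply/seteqP; split; last exact: min_face_sub_minimal.
move=> x Fx; rewrite min_face_active; last by case: Fp.
split; first by case: Fx.
have [Px _] := Fx; have [Pp _] := Fp.
pose y := p + (1/2) *: (x - p).
have Fy : minimal_locus g P y.
  by apply: (convex_minimal (convex_inequalities (b := b))) => //; lra.
have act i : i \in active y -> (i \in active p) /\ (i \in active x).
  rewrite !inE /y lformDr lformZr lformBr => /eqP h.
  by have := Px i; have := Pp i; split; apply/eqP; lra.
have sub : active y \subset active p by apply/fintype.subsetP => i /act[].
have /eqP <- : active y == active p.
  by rewrite eqEcard sub pk; apply: kmin; apply/asboolP; exists y.
by apply/fintype.subsetP => i /act[].
Qed.

(** Around a relative interior point, a polyhedron is defined by its active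
    constraints, and these vanish on its direction. *)
Lemma direction_active p v : relint P p ->
  (v \in direction P <-> forall i, i \in active p -> lform (A i) v = 0).
Proof.
move=> [Pp pin]; split=> [vP i ia|v0].
  have ge0 w : w \in direction P -> 0 <= lform (A i) w.
    move=> /pin[e e0 Pe]; have := Pe i; move: ia; rewrite inE => /eqP ia.
    by rewrite lformDr lformZr ia lerDl pmulr_rge0.
  apply/eqP; rewrite eq_le ge0// andbT -oppr_ge0 -lformNr.
  by apply: ge0; rewrite memvN.
apply: (@tcone_direction _ _ P p) => //; apply: tcone_active => // i /v0 ->.
exact: lexx.
Qed.

End Active.

(** The solution space of an integral linear system is spanned by integral
    vectors: the kernel of a rational matrix computes the kernel over the reals,
    and its rows become integral after clearing denominators. *)
Lemma rational_kernel (m : nat) (A : 'I_m -> 'rV[R]_n) (g : 'rV[R]_n) :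
  (forall i, integral_vec (A i)) ->
  (forall v, integral_vec v -> (forall i, lform (A i) v = 0) -> lform g v = 0) ->
  forall v, (forall i, lform (A i) v = 0) -> lform g v = 0.
Proof.
move=> iA gint v vA.
pose M : 'M[rat]_(n, m) := \matrix_(j, i) (Num.floor (A i 0 j))%:~R.
pose MR : 'M[R]_(n, m) := map_mx ratr M.
have MRE w i : (w *m MR) 0 i = lform (A i) w.
  rewrite mxE; apply: eq_bigr => j _; rewrite !mxE ratr_int mulrC.
  by congr (_ * _); exact/floorK/iA.
have /sub_kermxP/submxP[D ->] : v *m MR = 0.
  by apply/rowP => i; rewrite MRE vA mxE.
rewrite mulmx_sum_row.
have -> : lform g (\sum_i D 0 i *: row i (kermx MR)) =
  \sum_i lform g (D 0 i *: row i (kermx MR)) by exact: lform_sumr.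
rewrite big1// => k _; rewrite lformZr.
pose r := row k (kermx M).
have rE : row k (kermx MR) = map_mx ratr r by rewrite map_row map_kermx.
pose N : int := \prod_j denq (r 0 j).
have N0 : N != 0 by apply/prodf_neq0 => j _; exact: denq_neq0.
have NR0 : (N%:~R : R) != 0 by rewrite intr_eq0.
have intN : integral_vec (N%:~R *: row k (kermx MR)).
  move=> j; rewrite rE mxE [X in _ * X]mxE /N (bigD1 j)//= rmorphM/= mulrAC.
  have -> : (denq (r 0 j))%:~R * ratr (r 0 j) = (numq (r 0 j))%:~R :> R.
    by rewrite -ratr_int -rmorphM/= mulrC -numqE ratr_int.
  by rewrite rpredM// intr_int.
have kerN i : lform (A i) (N%:~R *: row k (kermx MR)) = 0.
  by rewrite -MRE -scalemxAl -row_mul mulmx_ker [LHS]mxE [X in _ * X]mxE mxE mulr0.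
have := gint _ intN kerN; rewrite lformZr => /eqP.
by rewrite mulf_eq0 (negPf NR0)/= => /eqP ->; rewrite mulr0.
Qed.

Lemma polyhedron_face P D : rational_polyhedron P -> is_face D P ->
  exists2 p, D p & D = min_face P p.
Proof.
move=> [m [A [b [_ ->]]]] [D0 [g Dg]].
by move: D0; rewrite Dg => /minimal_locus_min_face[p]; exists p.
Qed.

Lemma polyhedron_min_face P p : rational_polyhedron P -> P p ->
  exists2 g, integral_vec g & min_face P p = minimal_locus g P.
Proof.
move=> [m [A [b [iA ->]]]] Pp; exists (\sum_(i in active A b p) A i).
  exact: integral_vec_sum.
exact: min_face_minimal_locus.
Qed.

Lemma min_face_is_face P p : rational_polyhedron P -> P p -> is_face (min_face P p) P.
Proof.
move=> rP Pp; split; first by exists p; exact: min_face_self.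
by have [g _ ->] := polyhedron_min_face rP Pp; exists g.
Qed.

Lemma relint_exists P : rational_polyhedron P -> P !=set0 ->
  exists p, relint P p.
Proof.
move=> rP P0; have [p Pp PE] := polyhedron_face rP (is_face_refl P0).
exists p; rewrite PE; apply: relint_min_face => //; exact: polyhedron_convex.
Qed.

(** The direction of a rational polyhedron is spanned by integral vectors, stated
    dually: an integral vector on which [g] does not vanish can be found as soon
    as [g] is not zero on the direction. *)
Lemma direction_rational P g : rational_polyhedron P -> P !=set0 ->
  (forall v, integral_vec v -> v \in direction P -> lform g v = 0) ->
  forall v, v \in direction P -> lform g v = 0.
Proof.
move=> rP P0; have [p pin] := relint_exists rP P0.
move: rP pin => [m [A [b [iA ->]]]] pin gint v /(direction_active _ pin) vA.
(* Constraints that are not active are replaced by 0. *)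
pose B i := if i \in active A b p then A i else 0.
have iB i : integral_vec (B i).
  by rewrite /B; case: ifP => // _ j; rewrite mxE rpred0.
have BE w : (forall i, lform (B i) w = 0) <->
    (forall i, i \in active A b p -> lform (A i) w = 0).
  split=> h i; first by move=> ia; have := h i; rewrite /B ia.
  rewrite /B; case: ifP => [/h //|_].
  by rewrite /lform big1// => j _; rewrite mxE mul0r.
apply: (rational_kernel iB); last exact/BE.
by move=> w iw /BE h; apply: gint => //; exact/(direction_active _ pin).
Qed.

End Polyhedra.

(** * Half-spaces and primitive vectors *)

Section Rays.
Variables (R : realType) (n : nat).
Implicit Types (u v w : 'rV[R]_n) (L : {vspace 'rV[R]_n}).

Lemma mem_add_line L u v :
  v \in (L + <[u]>)%VS <-> exists c : R, v - c *: u \in L.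
Proof.
split=> [/memv_addP[l lL [_ /vlineP[c ->] ->]]|[c h]].
  by exists c; rewrite addrK.
by rewrite -[v](subrK (c *: u)) memv_add// memvZ// memv_line.
Qed.

Lemma dim_add_line L u : u \notin L -> \dim (L + <[u]>)%VS = (\dim L).+1.
Proof.
move=> uL; have u0 : u != 0 by apply: contraNneq uL => ->; exact: mem0v.
rewrite dimv_disjoint_sum ?dim_vline ?u0 ?addn1//.
apply/eqP; rewrite -subv0; apply/subvP => v; rewrite memv_cap memv0.
move=> /andP[vL /vlineP[c vc]]; move: vL; rewrite vc.
have [-> _|c0 cL] := eqVneq c 0; first by rewrite scale0r.
by move: uL; rewrite -[u](scalerK c0) memvZ.
Qed.

(** The half-space of [L + R u] on the side of [u]. *)
Definition ray L u : set 'rV[R]_n := [set v | exists2 c : R, 0 <= c & v - c *: u \in L].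

(** [u] generates the lattice of [L + R u] modulo that of [L]. *)
Definition primitive L u := [/\ u \notin L, integral_vec u &
  forall v, integral_vec v -> v \in (L + <[u]>)%VS -> exists k : int, v - u *~ k \in L].

Lemma ray_self L u : ray L u u.
Proof. by exists 1 => //; rewrite scale1r subrr mem0v. Qed.

Lemma ray_span L u v : ray L u v -> v \in (L + <[u]>)%VS.
Proof. by move=> [c _ h]; apply/mem_add_line; exists c. Qed.

(** Each of the two vectors is an integer multiple of the other modulo [L], so
    the product of the two integers is 1. *)
Lemma primitive_line L u u' : primitive L u -> primitive L u' ->
  u' \in (L + <[u]>)%VS -> u' - u \in L \/ u' + u \in L.
Proof.
move=> [uL iu gu] [u'L iu' gu'] u'span.
have [k hk] := gu _ iu' u'span.
have [c hc] : exists c : R, u' - c *: u \in L by apply/mem_add_line.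
have c0 : c != 0.
  by apply: contraNneq u'L => c0; move: hc; rewrite c0 scale0r subr0.
have uspan : u \in (L + <[u']>)%VS.
  apply/mem_add_line; exists c^-1.
  have -> : u - c^-1 *: u' = - c^-1 *: (u' - c *: u).
    by rewrite scaleNr scalerBr scalerK// opprB.
  exact: memvZ.
have [k' hk'] := gu' _ iu uspan.
have : (1 - k' * k)%:~R *: u \in L.
  have -> : (1 - k' * k)%:~R *: u = (u - u' *~ k') + k'%:~R *: (u' - u *~ k).
    rewrite -!scaler_int scalerBr addrA subrK scalerA intrB intrM.
    by rewrite scalerBl scale1r.
  by rewrite memvD// memvZ.
have [kk _|kk uL'] := eqVneq (1 - k' * k) 0; last first.
  by move: uL; rewrite -[u](scalerK (_ : (1 - k' * k)%:~R != 0 :> R)) ?intr_eq0// memvZ.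
have : k = 1 \/ k = -1.
  have : (k' * k == 1)%R by rewrite eq_sym -subr_eq0 kk.
  have [-> |k0] := eqVneq k 0; first by rewrite mulr0.
  move=> /eqP e; have : (`|k'| * `|k| = 1)%N by rewrite -abszM e.
  by move=> /eqP; rewrite muln_eq1 => /andP[_ /eqP]; lia.
case=> kE; move: hk; rewrite kE.
  by rewrite mulr1z; left.
by rewrite mulrN1z opprK; right.
Qed.

Lemma primitive_ray L u u' : primitive L u -> primitive L u' -> ray L u u' ->
  u' - u \in L.
Proof.
move=> pu pu' r; have [//|h] := primitive_line pu pu' (ray_span r).
have [uL _ _] := pu; have [c c0 hc] := r.
have c1 : c + 1 != 0 by rewrite gt_eqF// ltr_wpDl.
case/negP: uL; rewrite -[u](scalerK c1) memvZ//.
have -> : (c + 1) *: u = (u' + u) - (u' - c *: u).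
  by rewrite opprB [RHS]addrC addrA subrK scalerDl scale1r.
exact: memvB.
Qed.

Lemma primitiveN L u : primitive L u -> primitive L (- u).
Proof.
move=> [uL iu gu]; split=> [||v iv]; first by rewrite memvN.
  by move=> i; rewrite mxE rpredN.
move=> /mem_add_line[c hc]; have [|k hk] := gu v iv.
  by apply/mem_add_line; exists (- c); rewrite scaleNr -scalerN.
by exists (- k); rewrite mulrNz mulNrz opprK.
Qed.

Lemma ray_line L u v : v \in (L + <[u]>)%VS -> ray L u v \/ ray L (- u) v.
Proof.
move=> /mem_add_line[c hc]; have [c0|c0] := leP 0 c; first by left; exists c.
right; exists (- c); first by rewrite oppr_ge0 ltW.
by rewrite scalerN scaleNr opprK.
Qed.

Lemma ray_congr L u u' v : u' - u \in L -> ray L u v -> ray L u' v.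
Proof.
move=> uu' [c c0 hc]; exists c => //.
have -> : v - c *: u' = (v - c *: u) - c *: (u' - u).
  by rewrite scalerBr opprB addrA subrK.
by rewrite memvB// memvZ.
Qed.

End Rays.

(** * Facets and lattice normal vectors *)

Section Facets.
Variables (R : realType) (n : nat).
Implicit Types (s t : set 'rV[R]_n) (p q u v : 'rV[R]_n).

Definition is_facet t s := is_face t s /\ (pdim t).+1 = pdim s.

Lemma minimal_locus_direction s g v :
  v \in direction (minimal_locus g s) -> lform g v = 0.
Proof.
apply: lform_lspan_eq0 => _ [a [b [[sa amin] [sb bmin] ->]]].
by apply/eqP; rewrite lformBr subr_eq0 eq_le amin// bmin.
Qed.

(** The difference [w] of a point outside the facet and a point on it spans the
    direction modulo that of the facet, for reasons of dimension. *)
Lemma facet_split s g p : (pdim (minimal_locus g s)).+1 = pdim s ->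
  minimal_locus g s p -> exists w, [/\ tcone s p w, 0 < lform g w &
    direction s = (direction (minimal_locus g s) + <[w]>)%VS].
Proof.
set t := minimal_locus g s => dimt tp.
have [y sy ty] : exists2 y, s y & ~ t y.
  apply: contrapT => no; have : s `<=` t.
    by move=> y sy; apply: contrapT => ty; apply: no; exists y.
  by move=> /pdimS; rewrite -dimt ltnn.
have gy : 0 < lform g (y - p).
  rewrite lformBr subr_gt0 ltNge; apply/negP => le; apply: ty; split=> // z sz.
  by apply: le_trans le _; case: tp => _; exact.
exists (y - p); split=> //; first exact: tcone_sub.
have yt : y - p \notin direction t.
  by apply/negP => /minimal_locus_direction g0; rewrite g0 ltxx in gy.
apply/esym/eqP; rewrite eqEdim; apply/andP; split; last first.
  by rewrite dim_add_line// -/(pdim t) dimt.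
rewrite subv_add directionS; last by move=> ? [].
rewrite -memvE direction_mem//; by case: tp.
Qed.

Lemma facet_direction s g v : (pdim (minimal_locus g s)).+1 = pdim s ->
  minimal_locus g s !=set0 -> v \in direction s -> lform g v = 0 ->
  v \in direction (minimal_locus g s).
Proof.
move=> dimt [p tp]; have [w [_ gw ->]] := facet_split dimt tp.
move=> /mem_add_line[c hc] gv; have := minimal_locus_direction hc.
rewrite lformBr lformZr gv sub0r => /eqP; rewrite oppr_eq0 mulf_eq0 (gt_eqF gw) orbF.
by move=> /eqP c0; move: hc; rewrite c0 scale0r subr0.
Qed.

(** Seen from a relative interior point of a facet, a convex set is a
    half-space. *)
Lemma facet_tcone s g p v : convex s -> (pdim (minimal_locus g s)).+1 = pdim s ->
  relint (minimal_locus g s) p ->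
  tcone s p v <-> v \in direction s /\ 0 <= lform g v.
Proof.
move=> cs dimt [tp pin]; have [w [tw gw Vs]] := facet_split dimt tp.
have [sp pmin] := tp; split=> [tv|[+ gv]].
  split; first exact: tcone_direction tv.
  case: tv => e e0 /pmin; rewrite lformDr lformZr lerDl.
  by rewrite pmulr_rge0.
rewrite Vs => /mem_add_line[c hc]; rewrite -[v](subrK (c *: w)).
apply: tconeD => //; first by apply: tconeS (pin _ hc) => ? [].
apply: tconeZ => //; have := minimal_locus_direction hc.
rewrite lformBr lformZr => /eqP; rewrite subr_eq0 => /eqP gvE.
by move: gv; rewrite gvE pmulr_lge0.
Qed.

Lemma lform_integral (g v : 'rV[R]_n) : integral_vec g -> integral_vec v ->
  lform g v \is a Num.int.
Proof. by move=> ig iv; apply: rpred_sum => i _; exact: rpredM. Qed.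

(** An integral form cutting out the facet takes a nonzero value on an integral
    vector of the direction, hence has a least positive value; Euclidean division
    shows that a vector with this value is a generator. *)
Lemma normal_exists s t : rational_polyhedron s -> is_facet t s ->
  exists u, is_normal s t u.
Proof.
move=> rs [ts dimt].
have [p tp tE] := polyhedron_face rs ts.
have sp : s p by have := face_subset ts tp.
have [g ig gE] := polyhedron_min_face rs sp.
have {gE} tE : t = minimal_locus g s by rewrite tE.
have {}dimt : (pdim (minimal_locus g s)).+1 = pdim s by rewrite -tE.
have {}tp : minimal_locus g s p by rewrite -tE.
pose Q k := `[< (0 < k)%N /\ exists2 v, lattice s v & lform g v = k%:R >].
have exQ : exists k, Q k.
  have [w [tw gw _]] := facet_split dimt tp.
  have [v [iv vs gv]] : exists v,
      [/\ integral_vec v, v \in direction s & lform g v != 0].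
    apply: contrapT => no.
    have : lform g w = 0.
      apply: (direction_rational rs _ _ (tcone_direction sp tw)); first by exists p.
      move=> v iv vs; apply: contrapT => /eqP gv.
      by apply: no; exists v.
    by move=> g0; rewrite g0 ltxx in gw.
  have [z gz] : exists z : int, lform g v = z%:~R.
    exists (Num.floor (lform g v)); exact/esym/floorK/lform_integral.
  exists `|z|%N; apply/asboolP; split.
    by rewrite absz_gt0; apply: contraNneq gv => z0; rewrite gz z0.
  have [z0|z0] := leP 0 z.
    by exists v => //; rewrite gz -[in LHS](gez0_abs z0).
  exists (- v); first by split; rewrite ?memvN// => i; rewrite mxE rpredN.
  by rewrite lformNr gz -mulrNz -[in LHS](ltz0_abs z0).
case: (ex_minnP exQ) => m /asboolP[m0 [u [us iu] gu]] mmin.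
exists u; split=> //; last first.
  by exists g; split=> //; rewrite gu ltr0n.
move=> v [vs iv].
have [z gz] : exists z : int, lform g v = z%:~R.
  exists (Num.floor (lform g v)); exact/esym/floorK/lform_integral.
exists (z %/ m)%Z.
have ivk : integral_vec (v - u *~ (z %/ m)%Z).
  by move=> i; rewrite -scaler_int !mxE rpredB// rpredM// intr_int.
have vks : v - u *~ (z %/ m)%Z \in direction s by rewrite -scaler_int memvB// memvZ.
have gvk : lform g (v - u *~ (z %/ m)%Z) = (z %% m)%Z%:~R.
  rewrite lformBr lformMz gz gu {1}(divz_eq z m) intrD intrM.
  by rewrite -[m%:R *~ _]mulrzl -[m%:Z%:~R]pmulrn addrAC subrr add0r.
split=> //; rewrite tE; apply: facet_direction => //; first by exists p.
have mnz : (m%:Z != 0) by rewrite -lt0n.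
rewrite gvk; have := modz_ge0 z mnz; have := @ltz_pmod z m m0.
case: (z %% m)%Z gvk => // r gvk rm _.
have [-> //|r0] := eqVneq r 0%N.
have : (m <= r)%N.
  apply: mmin; apply/asboolP; split; first by rewrite lt0n.
  by exists (v - u *~ (z %/ m)%Z).
by rewrite leqNgt -ltz_nat rm.
Qed.

Lemma lattice_normalP s t : rational_polyhedron s -> is_facet t s ->
  is_normal s t (lattice_normal s t).
Proof. by move=> rs ts; apply: xgetPex; exact: normal_exists. Qed.

Section Normal.
Variables (s t : set 'rV[R]_n).
Hypotheses (rs : rational_polyhedron s) (ts : is_facet t s).
Let u := lattice_normal s t.

Lemma normal_direction : direction s = (direction t + <[u]>)%VS.
Proof.
have [[us iu] _ [g [_ tE gu]]] := lattice_normalP rs ts.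
apply/esym/eqP; rewrite eqEdim; case: ts => tf dimt; apply/andP; split.
  by rewrite subv_add -memvE us andbT; apply: directionS; exact: face_subset tf.
rewrite dim_add_line -/(pdim t) ?dimt//.
apply/negP; rewrite -tE => /minimal_locus_direction.
by move=> g0; rewrite g0 ltxx in gu.
Qed.

Lemma normal_primitive : primitive (direction t) u.
Proof.
have [[us iu] gen [g [_ tE gu]]] := lattice_normalP rs ts.
split=> // [|v iv]; last first.
  by rewrite -normal_direction => vs; have [k []] := gen v (conj vs iv); exists k.
apply/negP; rewrite -tE => /minimal_locus_direction.
by move=> g0; rewrite g0 ltxx in gu.
Qed.

(** Hence the class of the lattice normal modulo the direction of the facet only
    depends on the half-space spanned by the cell, which allows normals of
    different complexes to be compared. *)
Lemma normal_tcone p : relint t p -> tcone s p = ray (direction t) u.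
Proof.
have [_ _ [g [_ tE gu]]] := lattice_normalP rs ts.
have [_ dimt] := ts => pin; rewrite -tE in pin dimt.
apply/seteqP; split=> v; rewrite (facet_tcone v (polyhedron_convex rs) dimt pin).
  rewrite normal_direction => -[/mem_add_line[c hc] gv]; exists c => //.
  move: hc gv; rewrite -tE => /minimal_locus_direction; rewrite lformBr lformZr.
  by move=> /eqP; rewrite subr_eq0 => /eqP ->; rewrite pmulr_lge0.
move=> vr; split; first by rewrite normal_direction; exact: ray_span.
case: vr => c c0; rewrite -tE => /minimal_locus_direction; rewrite lformBr lformZr.
by move=> /eqP; rewrite subr_eq0 => /eqP ->; rewrite mulr_ge0// ltW.
Qed.

End Normal.
End Facets.

(** * Cells of a polyhedral complex *)

Section Complex.
Variables (R : realType) (n : nat) (X : pcomplex R n).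
Implicit Types (s t : set 'rV[R]_n) (p q u v : 'rV[R]_n).

Lemma in_cells_dim s k : (s \in cells_dim X k) = (s \in cells X) && (pdim s == k).
Proof. by rewrite !inE. Qed.

Lemma cells_dimP s k : s \in cells_dim X k <-> s \in cells X /\ pdim s = k.
Proof.
by rewrite in_cells_dim; split=> [/andP[? /eqP]|[-> ->]] //; rewrite eqxx.
Qed.

Lemma cells_convex s : s \in cells X -> convex s.
Proof. by move=> /cells_polyhedron/polyhedron_convex. Qed.

Lemma min_face_cell s p : s \in cells X -> s p -> min_face s p \in cells X.
Proof.
move=> sX sp; apply: (cells_face sX); apply: min_face_is_face => //.
exact: (cells_polyhedron sX).
Qed.

(** In a complex, inclusion between cells is the face relation. *)
Lemma subset_face s t : s \in cells X -> t \in cells X -> t `<=` s -> is_face t s.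
Proof.
move=> sX tX ts; have stE : s `&` t = t by rewrite setIC; exact/setIidPl.
have := cells_inter sX tX; rewrite stE => h.
by case: (h (cells_neq0 tX)).
Qed.

Lemma min_face_subcell s t p : s \in cells X -> t \in cells X -> s p -> t p ->
  min_face s p `<=` t.
Proof.
move=> sX tX sp tp; have [|[_ [g gE]] _] := cells_inter sX tX; first by exists p.
apply: subset_trans (@subIsetr _ s t); rewrite gE; apply: min_face_sub_minimal.
by rewrite -gE.
Qed.

Lemma relint_subcell s t p : s \in cells X -> t \in cells X ->
  relint s p -> t p -> s `<=` t.
Proof.
move=> sX tX ip tp; rewrite -{1}(min_face_relint ip); apply: min_face_subcell => //.
by case: ip.
Qed.

(** Cells not containing [p] stay away from its neighbourhood; so a segment
    starting at [p] inside the support begins inside one cell through [p]. *)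
Lemma germ_cell p v : small (fun t : R => Defs.support X (p + t *: v)) ->
  exists s, [/\ s \in cells X, s p & tcone s p v].
Proof.
move=> sup; have out : small (fun t : R => forall s, s \in enum_fset (cells X) ->
    ~ s p -> ~ s (p + t *: v)).
  apply: small_all => s sX; have [sp|sp] := pselect (s p); first exact: smallT.
  by apply: smallW (polyhedron_avoid v (cells_polyhedron sX) sp).
have [t [t0 _ [[s sX st] h]]] := small_ex ltr01 (smallI sup out).
exists s; split=> //; last by exists t.
by apply: contrapT => sp; exact: h sX sp st.
Qed.

Variable d : nat.
Hypothesis pureX : pure d X.

Lemma pure_cell s : s \in cells X -> exists2 s', s' \in cells_dim X d & s `<=` s'.
Proof. by move=> /(proj2 pureX)[s' s'X ss']; exists s' => //; exact: face_subset. Qed.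

Lemma pure_dim_le s : s \in cells X -> (pdim s <= d)%N.
Proof. by move=> /pure_cell[s' /cells_dimP[_ <-]]; exact: pdimS. Qed.

Lemma pure_nonempty : exists s, s \in cells_dim X d.
Proof. by have [[s sX] h] := pureX; have [s' ? _] := h s sX; exists s'. Qed.

(** The intersection of the two cells is a face of both of full dimension. *)
Lemma top_eq s t : s \in cells_dim X d -> t \in cells X ->
  (s `&` t) !=set0 -> (d <= pdim (s `&` t))%N -> s = t.
Proof.
move=> /cells_dimP[sX ds] tX st0 dim.
have [fs ft] := cells_inter sX tX st0.
have es : s `&` t = s by apply: face_eq fs _; rewrite ds.
rewrite es in ft dim; apply: face_eq ft _.
by rewrite ds; exact: pure_dim_le.
Qed.

Lemma relint_top_eq s t p : s \in cells_dim X d -> t \in cells X ->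
  relint s p -> t p -> s = t.
Proof.
move=> sX tX ip tp; have [sX' ds] := (iffLR (cells_dimP _ _) sX).
have sp : s p by case: ip.
apply: top_eq => //; first by exists p.
by have /setIidPl -> := relint_subcell sX' tX ip tp; rewrite ds.
Qed.

Lemma germ_top p v : small (fun t : R => Defs.support X (p + t *: v)) ->
  exists s, [/\ s \in cells_dim X d, s p & tcone s p v].
Proof.
move=> /germ_cell[s [sX sp tv]]; have [s' s'X ss'] := pure_cell sX.
by exists s'; split=> //; [exact: ss'|exact: tconeS tv].
Qed.

End Complex.

(** * Cells that share a half-space *)

Section Overlap.
Variables (R : realType) (n : nat).
Implicit Types (C D s t : set 'rV[R]_n) (p u v : 'rV[R]_n) (L : {vspace 'rV[R]_n}).

Lemma ray_tcone L C p u v : convex C -> C p -> (forall l, l \in L -> tcone C p l) ->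
  tcone C p u -> ray L u v -> tcone C p v.
Proof.
move=> cC Cp LC tu [c c0 hc]; rewrite -[v](subrK (c *: u)).
by apply: tconeD => //; [exact: LC|exact: tconeZ].
Qed.

(** Two convex sets that both contain a germ of the half-space [ray L u] at [p]
    meet in dimension at least that of [L + R u]. *)
Lemma overlap_dim L C D p u : convex C -> convex D -> C p -> D p ->
  (forall l, l \in L -> tcone C p l) -> (forall l, l \in L -> tcone D p l) ->
  u \notin L -> tcone C p u -> tcone D p u -> ((\dim L).+1 <= pdim (C `&` D))%N.
Proof.
move=> cC cD Cp Dp LC LD uL uC uD; rewrite -(dim_add_line uL); apply: dimvS.
have CDp : (C `&` D) p by split.
rewrite subv_add; apply/andP; split.
  apply/subvP => l lL; apply: (tcone_direction CDp).
  by apply: tconeI => //; [exact: LC|exact: LD].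
by rewrite -memvE; apply: (tcone_direction CDp); exact: tconeI.
Qed.

Lemma top_eq_cone d (X : pcomplex R n) s t L p u : pure d X ->
  s \in cells_dim X d -> t \in cells_dim X d -> (\dim L).+1 = d -> s p -> t p ->
  (forall l, l \in L -> tcone s p l) -> (forall l, l \in L -> tcone t p l) ->
  u \notin L -> tcone s p u -> tcone t p u -> s = t.
Proof.
move=> pX sX tX dL sp tp Ls Lt uL us ut.
have [sX' _] := (iffLR (cells_dimP _ _ _) sX).
have [tX' _] := (iffLR (cells_dimP _ _ _) tX).
apply: (top_eq pX sX tX'); first by exists p.
rewrite -dL; apply: overlap_dim uL us ut => //.
  exact: cells_convex sX'.
exact: cells_convex tX'.
Qed.

End Overlap.

(** * Balancing at a point *)

Section LocalBalance.
Variables (R : realType) (n d : nat).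
Implicit Types (p u v : 'rV[R]_n) (L : {vspace 'rV[R]_n}).

(** The weight of [Y] on the germ at [p] in direction [u].  It is meaningful when
    only one maximal cell contains that germ ([local_weightE]). *)
Definition local_weight (Y : wcomplex R n d) p u : int :=
  if [pick s : cells_dim Y d | `[< val s p /\ tcone (val s) p u >]] is Some s
  then wt Y s else 0.

Lemma top_val (Y : pcomplex R n) (s : cells_dim Y d) :
  val s \in cells Y /\ pdim (val s) = d.
Proof. exact/cells_dimP/valP. Qed.

Variant local_weight_spec (Y : wcomplex R n d) p u : int -> Prop :=
| LocalWeightSome (s : cells_dim Y d) of val s p & tcone (val s) p u :
    local_weight_spec Y p u (wt Y s)
| LocalWeightNone of (forall s : cells_dim Y d, val s p -> ~ tcone (val s) p u) :
    local_weight_spec Y p u 0.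

Lemma local_weightP (Y : wcomplex R n d) p u :
  local_weight_spec Y p u (local_weight Y p u).
Proof.
rewrite /local_weight; case: pickP => [s /asboolP[]|no].
  exact: LocalWeightSome.
apply: LocalWeightNone => s sp tu.
by have /asboolP := no s; apply.
Qed.

Variables (Y : tropical_cycle R n d) (p : 'rV[R]_n) (L : {vspace 'rV[R]_n}).
Hypothesis dimL : (\dim L).+1 = d.
Hypothesis LY : forall s : cells_dim Y d, val s p ->
  forall l, l \in L -> tcone (val s) p l.

Lemma local_weightE u (s : cells_dim Y d) : u \notin L -> val s p ->
  tcone (val s) p u -> local_weight Y p u = wt Y s.
Proof.
move=> uL sp us; case: local_weightP => [t tp ut|/(_ s sp us)//].
congr (wt Y _); apply: val_inj.
apply: (top_eq_cone (wcx_pure Y) (valP t) (valP s) dimL tp sp) ut us => //.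
  exact: LY.
exact: LY.
Qed.

Variables (I : finType) (P : pred I) (u : I -> 'rV[R]_n).
Hypothesis uprim : forall i, P i -> primitive L (u i).
Hypothesis uinj : forall i j, P i -> P j -> u i - u j \in L -> i = j.
Hypothesis ucover : forall (s : cells_dim Y d) v, val s p -> tcone (val s) p v ->
  exists2 i, P i & ray L (u i) v.

Let uL i : P i -> u i \notin L. Proof. by move=> /uprim[]. Qed.

(** If [p] is interior to a maximal cell [s], the star of [Y] at [p] is the span
    of [s], which consists of exactly two of the half-spaces.  Their primitive
    vectors are opposite modulo [L] and carry the same weight. *)
Lemma local_balance_relint (s : cells_dim Y d) : relint (val s) p ->
  \sum_(i | P i) u i *~ local_weight Y p (u i) \in L.
Proof.
move=> ip; have [sY ds] := top_val s; have [sp pin] := ip.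
have only (t : cells_dim Y d) : val t p -> t = s.
  move=> tp; apply/esym/val_inj.
  by apply: (relint_top_eq (wcx_pure Y) (valP s) _ ip tp); case: (top_val t).
have Ls : (L <= direction (val s))%VS.
  by apply/subvP => l lL; apply: (tcone_direction sp); exact: LY.
have [v vs vL] : exists2 v, v \in direction (val s) & v \notin L.
  apply: contrapT => no; have : (\dim (direction (val s)) <= \dim L)%N.
    apply/dimvS/subvP => v vs; apply: contrapT => /negP vL.
    by apply: no; exists v.
  by rewrite -/(pdim _) ds => le; move: dimL; lia.
have Vs : direction (val s) = (L + <[v]>)%VS.
  apply/esym/eqP; rewrite eqEdim subv_add Ls -memvE vs/= dim_add_line// dimL.
  by move: ds; rewrite /pdim => ->.
(* [v] and [- v] point to the two sides of [L] in the span of the cell. *)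
have [i Pi vi] := ucover sp (pin _ vs).
have [j Pj vj] : exists2 j, P j & ray L (u j) (- v).
  by apply: (ucover sp); apply: pin; rewrite memvN.
have inV k w : P k -> w \notin L -> ray L (u k) w ->
    exists2 c : R, 0 < c & u k - c *: w \in L.
  move=> Pk wL [c]; rewrite le_eqVlt => /predU1P[<-|c0 h].
    by rewrite scale0r subr0 => wL'; rewrite wL' in wL.
  have cn0 : c != 0 by rewrite gt_eqF.
  exists c^-1; rewrite ?invr_gt0//.
  have -> : u k - c^-1 *: w = - c^-1 *: (w - c *: u k).
    by rewrite scaleNr scalerBr scalerK// opprB.
  exact: memvZ.
have [a a0 hi] := inV i v Pi vL vi.
have [b b0 hj] : exists2 b : R, 0 < b & u j + b *: v \in L.
  have [|b b0] := inV j (- v) Pj _ vj; first by rewrite memvN.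
  by rewrite scalerN opprK; exists b.
have Vi k : P k -> v \in (L + <[u k]>)%VS -> tcone (val s) p (u k).
  move=> Pk /mem_add_line[c hc]; apply: pin; rewrite Vs; apply/mem_add_line.
  have c0 : c != 0.
    by apply: contraNneq vL => c0; move: hc; rewrite c0 scale0r subr0.
  exists c^-1; have -> : u k - c^-1 *: v = - c^-1 *: (v - c *: u k).
    by rewrite scaleNr scalerBr scalerK// opprB.
  exact: memvZ.
have ti := Vi i Pi (ray_span vi).
have tj : tcone (val s) p (u j).
  by apply: (Vi j Pj); rewrite -memvN; exact: (ray_span vj).
(* Both [u i] and [- u j] are primitive and on the side of [v]. *)
have uij : u i + u j \in L.
  have : - u i \notin L by rewrite memvN uL.
  have pNi := primitiveN (uprim Pi).
  move=> _; have : ray L (- u i) (u j).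
    exists (b / a); first by rewrite divr_ge0// ltW.
    have -> : u j - (b / a) *: - u i = (u j + b *: v) + (b / a) *: (u i - a *: v).
      rewrite scalerN opprK scalerBr scalerA divfK ?gt_eqF//.
      by rewrite [RHS]addrACA addrN addr0.
    by rewrite memvD// memvZ.
  by move=> /(primitive_ray pNi (uprim Pj)); rewrite opprK addrC.
have ij : i != j.
  apply/negP => /eqP ijE; rewrite -ijE in uij.
  have := uL Pi; rewrite -[u i](@scalerK _ _ 2%:R) ?pnatr_eq0//.
  by rewrite scaler_nat mulr2n memvZ.
rewrite (bigD1 i)//= (bigD1 j)/=; last by rewrite Pj eq_sym.
rewrite (local_weightE (uL Pi) sp ti) (local_weightE (uL Pj) sp tj).
rewrite big1 ?addr0.
  by rewrite -!scaler_int -scalerDr memvZ.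
move=> k /andP[/andP[Pk ki] kj]; case: local_weightP => // t tp tk.
have tE := only t tp; rewrite tE in tk.
have : u k \in (L + <[u i]>)%VS.
  have := tcone_direction sp tk; rewrite Vs => /mem_add_line[c hc].
  apply/mem_add_line; exists (c / a).
  have -> : u k - (c / a) *: u i = (u k - c *: v) - (c / a) *: (u i - a *: v).
    by rewrite scalerBr scalerA divfK ?gt_eqF// opprB addrA subrK.
  by rewrite memvB// memvZ.
move=> /(primitive_line (uprim Pi) (uprim Pk))[h|h].
  by case/eqP: ki; exact: uinj.
case/eqP: kj; apply: uinj => //.
have -> : u k - u j = (u k + u i) - (u i + u j) by rewrite opprD addrA addrK.
exact: memvB.
Qed.

(** If the minimal face [r] through [p] has codimension one, [L] is its direction,
    the maximal cells through [p] are those having [r] as a facet, and each of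
    them looks from [p] like one of the half-spaces.  So the sum is the one of the
    balancing condition of [Y] at [r], reindexed by half-spaces. *)
Lemma local_balance_facet (s : cells_dim Y d) : val s p ->
  (pdim (min_face (val s) p)).+1 = d ->
  \sum_(i | P i) u i *~ local_weight Y p (u i) \in L.
Proof.
move=> sp; set r := min_face _ _ => dr.
have [sY ds] := top_val s.
have rY : r \in cells Y by exact: min_face_cell.
have cs := cells_convex sY.
have rp : relint r p by exact: relint_min_face.
have Lr : L = direction r.
  apply/eqP; rewrite eqEdim -ltnS dimL -/(pdim r) dr leqnn andbT.
  apply/subvP => l lL.
  apply: (tcone_direction (min_face_self sp)).
  have := LY sp; move=> Lt; have [e e0 se] := Lt _ lL.
  exists e => //; split=> //; rewrite opprD addNKr -scalerN.
  by apply: tconeZ (ltW e0) _ => //; apply: Lt; rewrite memvN.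
have facet (t : cells_dim Y d) : is_face r (val t) -> is_facet r (val t).
  by move=> rt; split=> //; rewrite dr; case: (top_val t).
pose nu (t : cells_dim Y d) := lattice_normal (val t) r.
have rat (t : cells_dim Y d) : rational_polyhedron (val t).
  by apply: (@cells_polyhedron _ _ Y); case: (top_val t).
have tcn (t : cells_dim Y d) : is_face r (val t) -> tcone (val t) p = ray L (nu t).
  by move=> /facet rt; rewrite Lr; exact: normal_tcone.
have pr (t : cells_dim Y d) : is_face r (val t) -> primitive L (nu t).
  by move=> /facet rt; rewrite Lr; exact: normal_primitive.
have face (t : cells_dim Y d) : val t p -> is_face r (val t).
  move=> tp; have [tY _] := top_val t; apply: (@subset_face _ _ Y) => //.
  exact: (@min_face_subcell _ _ Y).
have inr (t : cells_dim Y d) : is_face r (val t) -> val t p.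
  by move=> rt; apply: (face_subset rt); exact: min_face_self.
have ex (t : cells_dim Y d) : is_face r (val t) -> exists2 i, P i & nu t - u i \in L.
  move=> rt; have [||i Pi h] := @ucover t (nu t).
  - exact: inr.
  - by rewrite tcn//; exact: ray_self.
  by exists i => //; apply: primitive_ray h; [exact: uprim|exact: pr].
have [i0 Pi0 _] := ex s (face s sp).
(* The half-space that the cell [t] fills at [p]; [i0] is only a default value. *)
pose phi t := odflt i0 [pick i | P i && (nu t - u i \in L)].
have phiP (t : cells_dim Y d) : is_face r (val t) ->
    P (phi t) /\ nu t - u (phi t) \in L.
  move=> /ex[i Pi h]; rewrite /phi; case: pickP => [j /andP[]//|].
  by move=> /(_ i); rewrite Pi h.
have bal : \sum_(t : cells_dim Y d | `[< is_face r (val t) >]) nu t *~ wt Y t \in L.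
  by rewrite Lr; exact: (tc_balanced rY dr).
have -> : \sum_(i | P i) u i *~ local_weight Y p (u i) =
    \sum_(t : cells_dim Y d | `[< is_face r (val t) >]) u (phi t) *~ wt Y t.
  rewrite (partition_big phi P) => [|t /asboolP/phiP[]//].
  have tphi (t : cells_dim Y d) : is_face r (val t) -> tcone (val t) p (u (phi t)).
    move=> rt; rewrite tcn//; have [Pt ht] := phiP t rt.
    exact: ray_congr ht (ray_self _ _).
  apply: eq_bigr => i Pi; case: local_weightP => [t tp ti|none].
    have rt := face t tp.
    have phit : phi t = i.
      have [Pt ht] := phiP t rt; apply: uinj => //.
      have tn : u i - nu t \in L.
        by have := ti; rewrite tcn// => h; exact: primitive_ray (pr t rt) (uprim Pi) h.
      have -> : u (phi t) - u i = - (nu t - u (phi t)) - (u i - nu t).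
        by rewrite !opprB addrA subrK.
      by rewrite memvB// memvN.
    rewrite (bigD1 t)/=; last by rewrite phit eqxx andbT; exact/asboolP.
    rewrite phit big1 ?addr0// => t' /andP[/andP[/asboolP rt' /eqP pt'] /eqP].
    case; apply: val_inj; apply: (top_eq_cone (wcx_pure Y) (valP t') (valP t)
      dimL (inr _ rt') tp _ _ (uL Pi)) => //; [exact/LY/inr|exact: LY|].
    by have := tphi t' rt'; rewrite pt'.
  rewrite mulr0z big1// => t /andP[/asboolP rt /eqP pt].
  by case: (none t (inr t rt)); have := tphi t rt; rewrite pt.
have -> : \sum_(t : cells_dim Y d | `[< is_face r (val t) >]) u (phi t) *~ wt Y t =
    \sum_(t : cells_dim Y d | `[< is_face r (val t) >]) nu t *~ wt Y t -
    \sum_(t : cells_dim Y d | `[< is_face r (val t) >]) (nu t - u (phi t)) *~ wt Y t.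
  by rewrite -sumrB; apply: eq_bigr => t _; rewrite -mulrzBl opprB addrC subrK.
rewrite memvB// memv_suml// => t /asboolP rt.
by have [_ h] := phiP t rt; rewrite -scaler_int memvZ.
Qed.

(** The balancing condition freed from the polyhedral structure of [Y].  Since
    the star of [Y] at [p] is invariant under [L], the minimal face through [p]
    has codimension at most one, which leaves the two cases above. *)
Theorem local_balance : \sum_(i | P i) u i *~ local_weight Y p (u i) \in L.
Proof.
have [[s sp]|none] := pselect (exists s : cells_dim Y d, val s p); last first.
  rewrite big1 ?mem0v// => i Pi; case: local_weightP => // s sp.
  by case: none; exists s.
have [sY ds] := top_val s; have cs := cells_convex sY.
have mY : min_face (val s) p \in cells Y by exact: min_face_cell.
have [eq|ne] := eqVneq (pdim (min_face (val s) p)) d.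
  apply: (local_balance_relint (s := s)).
  have <- : min_face (val s) p = val s.
    apply: face_eq; last by rewrite eq ds.
    exact: (min_face_is_face (cells_polyhedron sY) sp).
  exact: relint_min_face.
apply: (local_balance_facet sp).
have le : (pdim (min_face (val s) p) <= d)%N by exact: (pure_dim_le (wcx_pure Y)).
suff : (\dim L <= pdim (min_face (val s) p))%N by lia.
apply: dimvS; apply/subvP => l lL; apply: (tcone_direction (min_face_self sp)).
have Lt := LY sp; have [e e0 se] := Lt _ lL.
exists e => //; split=> //; rewrite opprD addNKr -scalerN.
by apply: tconeZ (ltW e0) _ => //; apply: Lt; rewrite memvN.
Qed.

End LocalBalance.

(** * Following a segment through finitely many polyhedra *)

Section Path.
Variables (R : realType) (n : nat).
Implicit Types (p q v : 'rV[R]_n) (D r : set 'rV[R]_n).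

(** The parameters of the points of the segment covered by [l] form a closed set,
    which contains its supremum; the hypothesis excludes a supremum below 1. *)
Lemma continue_to_end (l : seq (set 'rV[R]_n)) p v :
  (forall D, D \in l -> rational_polyhedron D) ->
  (exists2 D, D \in l & D p) ->
  (forall t D, 0 <= t -> t < 1 -> D \in l -> D (p + t *: v) ->
    exists D', [/\ D' \in l, D' (p + t *: v) & tcone D' (p + t *: v) v]) ->
  exists2 D, D \in l & D (p + v).
Proof.
move=> poly [D0 D0l D0p] step.
pose E := [set t : R | [/\ 0 <= t, t <= 1 & exists2 D, D \in l & D (p + t *: v)]].
have E0 : E 0 by split=> //; exists D0 => //; rewrite scale0r addr0.
have ubE : ubound E 1 by move=> t [].
have supE : has_sup E by split; [exists 0|exists 1].
set T := sup E; have T0 : 0 <= T by exact: (ub_le_sup (proj2 supE)).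
have T1 : T <= 1 by apply: ge_sup => //; exists 0.
have [D Dl DT] : exists2 D, D \in l & D (p + T *: v).
  apply: contrapT => no.
  have [e e0 he] : small (fun t : R => forall D, D \in l ->
      ~ D (p + T *: v + t *: - v)).
    apply: small_all => D Dl; apply: polyhedron_avoid; first exact: poly.
    by move=> DT; apply: no; exists D.
  have [t [t0 t1 [D Dl Dt]] Tet] := sup_adherent e0 supE.
  have tT : t <= T by apply: (ub_le_sup (proj2 supE)); split=> //; exists D.
  have tneT : t != T by apply: contra_notN no => /eqP <-; exists D.
  apply: (he (T - t) _ _ D Dl).
  - by rewrite subr_gt0 lt_neqAle tneT.
  - by move: Tet; rewrite -/T; lra.
  - have -> // : p + T *: v + (T - t) *: - v = p + t *: v.
    by apply/rowP => i; rewrite !mxE; ring.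
have [T1'|T1'] := eqVneq T 1; first by exists D => //; rewrite -[v]scale1r -T1'.
have Tlt : T < 1 by rewrite lt_neqAle T1'.
have [D' [D'l D'T tc]] := step T D T0 Tlt Dl DT.
have sm := tcone_small (polyhedron_convex (poly _ D'l)) D'T tc.
have T2 : 0 < 1 - T by rewrite subr_gt0.
have [t [t0 t1 Dt]] := small_ex T2 sm.
have : E (T + t).
  split; [lra|lra|exists D' => //].
  by rewrite scalerDl addrA.
move=> /(ub_le_sup (proj2 supE)); rewrite -/T; lra.
Qed.

(** The union of the lines joining [p] to the points of [r]: if [q] is outside,
    the segment from [p] to [q] misses [r], except possibly at [p]. *)
Definition joining p r : set 'rV[R]_n :=
  [set x | exists c y, r y /\ x = p + c *: (y - p)].

Lemma pdim_joining p r : (pdim (joining p r) <= (pdim r).+1)%N.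
Proof.
have [[y0 ry0]|no] := pselect (exists y, r y); last first.
  have -> : joining p r = set0; last first.
    apply: (leq_trans _ (leq0n _)); rewrite leqn0 dimv_eq0 -subv0.
    by apply: lspan_sub => v [a [b []]].
  by apply/seteqP; split=> // x [c [y [ry _]]]; apply: no; exists y.
have jp : joining p r p by exists 0, y0; rewrite scale0r addr0.
have sub : (direction (joining p r) <= direction r + <[y0 - p]>)%VS.
  apply: (direction_sub jp) => x [c [y [ry ->]]].
  rewrite addrC addKr; apply/mem_add_line; exists c.
  by rewrite -scalerBr opprB addrA subrK memvZ// direction_mem.
apply: leq_trans (dimvS sub) _; apply: leq_trans (dimv_add_leqif _ _) _.
by rewrite -[(pdim r).+1]addn1 leq_add2l dim_vline; case: (_ != 0).
Qed.

End Path.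

(** * The weight induced by a cycle on a larger complex *)

Section Spread.
Variables (R : realType) (n d : nat) (X : pcomplex R n) (Y : tropical_cycle R n d).
Hypotheses (pureX : pure d X) (sYX : Defs.support Y `<=` Defs.support X).
Implicit Types (p q x v : 'rV[R]_n) (r s : set 'rV[R]_n).

Lemma relint_of_dim (Z : pcomplex R n) s p : s \in cells Z -> s p ->
  (forall r, r \in cells Z -> r p -> (pdim s <= pdim r)%N) -> relint s p.
Proof.
move=> sZ sp h; have cs := cells_convex sZ.
have <- : min_face s p = s.
  apply: face_eq; first exact: (min_face_is_face (cells_polyhedron sZ)).
  by apply: h; [exact: min_face_cell|exact: min_face_self].
exact: relint_min_face.
Qed.

Lemma top_germ_small (t : cells_dim Y d) x v : val t x -> tcone (val t) x v ->
  small (fun e : R => Defs.support Y (x + e *: v)).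
Proof.
move=> tx tv; have [tY _] := top_val t.
have := tcone_small (cells_convex tY) tx tv.
by apply: smallW => e _ te; exists (val t).
Qed.

Section Cross.
Variables (s : set 'rV[R]_n) (x : 'rV[R]_n).
Hypotheses (sX : s \in cells_dim X d) (sx : relint s x).

(** Near [x] the support of [X] is contained in the cell [s], so that a maximal
    cell of [Y] through [x] is parallel to it. *)
Lemma top_direction (t : cells_dim Y d) : val t x ->
  direction (val t) = direction s.
Proof.
move=> tx; have [tY dt] := top_val t.
have [_ ds] := (iffLR (cells_dimP _ _ _) sX).
apply/eqP; rewrite eqEdim -!/(pdim _) dt ds leqnn andbT.
apply: (direction_sub tx) => y ty.
have := top_germ_small tx (tcone_sub x ty).
move=> /(smallW (fun e _ => @sYX _))/(germ_top pureX)[s' [s'X s'x ts']].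
have [s'X' _] := (iffLR (cells_dimP _ _ _) s'X).
have -> := relint_top_eq pureX sX s'X' sx s'x.
exact: tcone_direction s'x ts'.
Qed.

(** Passing a face of [Y] inside a maximal cell of [X].  If [x] lies on a face [r]
    of codimension one, the star of [Y] at [x] is contained in the two half-spaces
    bounded by the direction of [r].  One of them is filled by [t], so local
    balancing forces the other one to be filled with the same weight. *)
Lemma cross v (t : cells_dim Y d) : v \in direction s -> val t x ->
  (forall r, r \in cells Y -> r x -> (d <= (pdim r).+1)%N) ->
  exists t' : cells_dim Y d, [/\ val t' x, tcone (val t') x v & wt Y t' = wt Y t].
Proof.
move=> vs tx low; have [tY dt] := top_val t.
have ct := cells_convex tY; have rt := cells_polyhedron tY.
set r := min_face (val t) x.
have rY : r \in cells Y by exact: min_face_cell.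
have rx : r x by exact: min_face_self.
have ir : relint r x by exact: relint_min_face.
have rtf : is_face r (val t) by exact: min_face_is_face.
have [dr|dr] := eqVneq (pdim r) d.
  exists t; split=> //; have <- : r = val t by apply: face_eq => //; rewrite dr dt.
  case: ir => _; apply; suff -> : r = val t by rewrite top_direction.
  by apply: face_eq => //; rewrite dr dt.
have {}dr : (pdim r).+1 = d.
  have := pdimS (face_subset rtf); rewrite dt; have := low r rY rx; lia.
pose L := direction r; pose u := lattice_normal (val t) r.
have rtF : is_facet r (val t) by split=> //; rewrite dr dt.
have pu : primitive L u by exact: normal_primitive.
have [uL _ _] := pu.
have tu : tcone (val t) x = ray L u by exact: normal_tcone.
have Vs : direction s = (L + <[u]>)%VS.
  by rewrite -(top_direction tx); exact: normal_direction.
have LY (t' : cells_dim Y d) : val t' x -> forall l, l \in L -> tcone (val t') x l.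
  move=> t'x l lL; have [t'Y _] := top_val t'.
  have sub : r `<=` val t' by exact: (@min_face_subcell _ _ Y).
  by apply: (tconeS sub); case: ir => _; apply.
(* The two sides of the face in the direction of [s]. *)
pose w (b : bool) := if b then u else - u.
have pw b : primitive L (w b) by case: b => //; exact: primitiveN.
have uu2 : u + u \notin L.
  apply: contra uL => h; rewrite -[u](@scalerK _ _ 2%:R) ?pnatr_eq0//.
  by rewrite scaler_nat mulr2n memvZ.
have winj b c : true -> true -> w b - w c \in L -> b = c.
  move=> _ _; case: b c => -[]//=; rewrite /w ?opprK => h.
    by rewrite h in uu2.
  by move: uu2; rewrite -memvN opprD h.
have wcov (t' : cells_dim Y d) v' : val t' x -> tcone (val t') x v' ->
    exists2 b, true & ray L (w b) v'.
  move=> t'x /(tcone_direction t'x); rewrite top_direction// Vs.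
  by move=> /ray_line[]; [exists true|exists false].
have := local_balance (P := xpredT) dr LY (fun b _ => pw b) winj wcov.
have -> : \sum_b w b *~ local_weight Y x (w b) =
    u *~ (local_weight Y x u - local_weight Y x (- u)).
  by rewrite big_bool/= mulrzBr mulNrz.
have -> : local_weight Y x u = wt Y t.
  by apply: (local_weightE dr LY) => //; rewrite tu; exact: ray_self.
case: local_weightP => [t' t'x t'u|_]; last first.
  rewrite subr0 => h; case/negP: uL; rewrite -[u](@scalerK _ _ (wt Y t)%:~R).
    by rewrite scaler_int memvZ.
  by rewrite intr_eq0 tc_neq0.
move=> h; have wE : wt Y t' = wt Y t.
  apply/esym/eqP; rewrite -subr_eq0; apply: contraTT h => wn.
  apply: contra uL => h; rewrite -[u](@scalerK _ _ (wt Y t - wt Y t')%:~R).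
    by rewrite scaler_int memvZ.
  by rewrite intr_eq0.
move: vs; rewrite Vs => /ray_line[h1|h1]; first by exists t; rewrite tu.
exists t'; split=> //; have [t'Y _] := top_val t'.
by apply: (ray_tcone (cells_convex t'Y) t'x (LY _ t'x) t'u).
Qed.

End Cross.

(** A segment starting in a cell of [Y] inside a maximal cell [s] of [X] stays in
    cells of the same weight, provided that it avoids the faces of [Y] of
    codimension at least two; the last two hypotheses ensure this. *)
Lemma connect s p q (t : cells_dim Y d) : s \in cells_dim X d ->
  relint s p -> s q -> val t p ->
  (forall r, r \in cells Y -> r p -> (d <= (pdim r).+1)%N) ->
  (forall r, r \in cells Y -> joining p r q -> (d <= pdim (joining p r))%N) ->
  exists2 t' : cells_dim Y d, val t' q & wt Y t' = wt Y t.
Proof.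
move=> sX ip sq tp lowp lowq; have [sp pin] := ip.
have [sX' _] := (iffLR (cells_dimP _ _ _) sX).
have cs := cells_convex sX'.
pose l := [seq val t' | t' <- enum {: cells_dim Y d} & wt Y t' == wt Y t].
have lP D : D \in l <-> exists2 t' : cells_dim Y d, D = val t' & wt Y t' = wt Y t.
  split=> [/mapP[t' + ->]|[t' -> wE]].
    by rewrite mem_filter => /andP[/eqP ? _]; exists t'.
  by apply: map_f; rewrite mem_filter wE eqxx mem_enum.
have [D /lP[t' -> wE]|||D Dl] := @continue_to_end _ _ l p (q - p).
- by apply: (@cells_polyhedron _ _ Y); case: (top_val t').
- by exists (val t) => //; apply/lP; exists t.
- move=> e D e0 e1 /lP[t' -> wE] t'e.
  set x := p + e *: (q - p).
  have sx : s x by apply: cs => //; exact: ltW.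
  (* Only the end point [q] may be on the boundary of [s]. *)
  have ix : relint s x.
    split=> // v /pin[f f0 sf]; exists ((1 - e) * f).
      by rewrite mulr_gt0 ?subr_gt0.
    have := cs _ _ e sf sq e0 (ltW e1); congr s.
    by apply/rowP => i; rewrite !mxE; ring.
  have low r : r \in cells Y -> r x -> (d <= (pdim r).+1)%N.
    move=> rY rx; have [e0'|e0'] := eqVneq e 0.
      by apply: lowp => //; move: rx; rewrite /x e0' scale0r addr0.
    apply: leq_trans (pdim_joining p r); apply: lowq => //.
    exists e^-1, x; split=> //.
    by rewrite /x [p + _ - p]addrC addKr scalerK// addrC subrK.
  have [t2 [t2x t2v t2w]] := cross sX ix (direction_mem sq sp) t'e low.
  by exists (val t2); split=> //; apply/lP; exists t2 => //; rewrite t2w.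
- by rewrite addrC subrK => Dq; move: Dl => /lP[t' tE wE]; exists t' => //; rewrite -tE.
Qed.

(** Nonemptiness matters for [d = 0], the empty set having dimension 0. *)
Definition overlap (C D : set 'rV[R]_n) := (C `&` D) !=set0 /\ (d <= pdim (C `&` D))%N.

Lemma overlap_generic s (t : cells_dim Y d) (l : seq (set 'rV[R]_n)) :
  s \in cells_dim X d -> overlap s (val t) ->
  exists p, [/\ relint s p, relint (val t) p &
    forall D, D \in l -> D p -> (d <= pdim D)%N].
Proof.
move=> sX [st0 dst]; have [sX' ds] := (iffLR (cells_dimP _ _ _) sX).
have [tY dt] := top_val t.
have cst : convex (s `&` val t).
  by apply: convexI; [exact: cells_convex sX'|exact: cells_convex tY].
have [p [sp tp] h] := generic_point
  (enum_fset (cells X) ++ enum_fset (cells Y) ++ l) id cst st0.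
have {}h D : D \in enum_fset (cells X) ++ enum_fset (cells Y) ++ l -> D p ->
    (d <= pdim D)%N.
  by move=> Dl Dp; apply: leq_trans dst _; exact: h.
exists p; split.
- apply: (relint_of_dim sX' sp) => r rX rp; rewrite ds; apply: h => //.
  by rewrite mem_cat rX.
- apply: (relint_of_dim tY tp) => r rX rp; rewrite dt; apply: h => //.
  by rewrite !mem_cat rX orbT.
- by move=> D Dl; apply: h; rewrite !mem_cat Dl !orbT.
Qed.

(** A point [q] of [s] outside the closed support of [Y] could be moved slightly
    to a general position, and then joined to a point of [t] inside [s]. *)
Lemma overlap_covered s (t : cells_dim Y d) : s \in cells_dim X d ->
  overlap s (val t) -> s `<=` Defs.support Y.
Proof.
move=> sX st q sq; apply: contrapT => qY.
have [sX' ds] := (iffLR (cells_dimP _ _ _) sX).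
have cs := cells_convex sX'.
have [p [ip [tp _] low]] := overlap_generic (enum_fset (cells Y)) sX st.
have [x sx sm] := generic_near (enum_fset (cells Y)) (joining p) cs sq.
have sm2 : small (fun e : R => forall r, r \in enum_fset (cells Y) ->
    ~ r (q + e *: (x - q))).
  apply: small_all => r rY; apply: (polyhedron_avoid _ (@cells_polyhedron _ _ Y _ rY)).
  by move=> rq; apply: qY; exists r.
(* This small displacement of [q] is in general position. *)
have [e [e0 e1 [h1 h2]]] := small_ex ltr01 (smallI sm sm2).
have [||r rY jr|t' t'q _] := @connect s p (q + e *: (x - q)) t sX ip _ tp.
- by apply: cs => //; exact: ltW.
- by move=> r rY rp; apply: leqW; exact: low.
- by rewrite -ds; exact: h1.
- by apply: (h2 _ _ t'q); case: (top_val t').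
Qed.

(** Join a general point of the first intersection to one of the second. *)
Lemma overlap_weight s (t1 t2 : cells_dim Y d) : s \in cells_dim X d ->
  overlap s (val t1) -> overlap s (val t2) -> wt Y t1 = wt Y t2.
Proof.
move=> sX st1 st2.
have [p [ip [tp _] low]] := overlap_generic (enum_fset (cells Y)) sX st1.
have [q [[sq _] iq low2]] :=
  overlap_generic [seq joining p r | r <- enum_fset (cells Y)] sX st2.
have [||t' t'q <-] := @connect s p q t1 sX ip sq tp.
- by move=> r rY rp; apply: leqW; exact: low.
- by move=> r rY; apply: low2; exact: map_f.
congr (wt Y _); apply: val_inj; apply/esym.
have [t'Y _] := top_val t'.
exact: (relint_top_eq (wcx_pure Y) (valP t2) t'Y iq t'q).
Qed.

(** By [overlap_weight] the choice of [t] does not matter when the support of [Y]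
    is contained in that of [X]. *)
Definition transfer : {ffun cells_dim X d -> int} :=
  [ffun s =>
    if [pick t : cells_dim Y d | `[< overlap (val s) (val t) >]] is Some t
    then wt Y t else 0].

Lemma transferE (s : cells_dim X d) (t : cells_dim Y d) :
  overlap (val s) (val t) -> transfer s = wt Y t.
Proof.
move=> st; rewrite ffunE; case: pickP => [t' /asboolP st'|/(_ t)/asboolP//].
exact: (overlap_weight (valP s)).
Qed.

(** If no maximal cell of [Y] contains the germ in direction [u], then [Y] does
    not cover [s], so by [overlap_covered] no cell of [Y] overlaps it. *)
Lemma transfer_local (s : cells_dim X d) p u L : val s p -> (\dim L).+1 = d ->
  (forall l, l \in L -> tcone (val s) p l) ->
  (forall t : cells_dim Y d, val t p -> forall l, l \in L -> tcone (val t) p l) ->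
  u \notin L -> tcone (val s) p u -> transfer s = local_weight Y p u.
Proof.
move=> sp dL Ls LY uL su; have [sX _] := top_val s.
have cs := cells_convex sX.
case: local_weightP => [t tp tu|none].
  have [tY _] := top_val t; have ct := cells_convex tY.
  apply: transferE; split; first by exists p.
  suff : ((\dim L).+1 <= pdim (val s `&` val t))%N by rewrite dL.
  by apply: overlap_dim uL su tu => //; exact: LY.
rewrite ffunE; case: pickP => // t /asboolP st.
have cov := overlap_covered (valP s) st.
have [|t' [t'Y t'p t'u]] := @germ_top _ _ Y _ (wcx_pure Y) p u.
  by apply: smallW (tcone_small cs sp su) => e _; exact: cov.
by case: (none (Sub t' t'Y) t'p).
Qed.

(** Let [p] be a general point of the codimension one cell [r]: in the relative
    interior of [r], and on no cell of [Y] that meets [r] in smaller dimension.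
    Then the cells of [Y] through [p] are invariant under the direction of [r]
    near [p], and the maximal cells of [X] containing [r] provide the half-spaces
    required by [local_balance]. *)
Lemma transfer_balanced : balanced transfer.
Proof.
move=> r rX dr; have cr := cells_convex rX.
have [p rp h] := generic_point
  (enum_fset (cells X) ++ [seq t `&` r | t <- enum_fset (cells Y)])
  id cr (cells_neq0 rX).
have ip : relint r p.
  apply: (relint_of_dim rX rp) => D DX; apply: h.
  by rewrite mem_cat DX.
have LY (t : cells_dim Y d) : val t p ->
    forall l, l \in direction r -> tcone (val t) p l.
  move=> tp l lr; have [tY _] := top_val t; have ct := cells_convex tY.
  set D := min_face (val t) p.
  have DY : D \in cells Y by exact: min_face_cell.
  have Dp : D p by exact: min_face_self.
  have dim : (pdim r <= pdim (D `&` r))%N.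
    apply: h; last by split.
    by rewrite mem_cat; apply/orP; right; apply/mapP; exists D.
  have /eqP eqD : (direction (D `&` r) == direction r)%VS.
    by rewrite eqEdim directionS.
  have [_ Din] : relint D p by exact: relint_min_face.
  apply: (tconeS (@min_face_subset _ _ _ p)); apply: Din.
  by apply: (subvP (directionS (@subIsetl _ D r))); rewrite eqD.
have facet (s : cells_dim X d) : is_face r (val s) -> is_facet r (val s).
  by move=> rs; split=> //; rewrite dr; case: (top_val s).
have rat (s : cells_dim X d) : rational_polyhedron (val s).
  by apply: (@cells_polyhedron _ _ X); case: (top_val s).
pose u (s : cells_dim X d) := lattice_normal (val s) r.
have tcn (s : cells_dim X d) : is_face r (val s) ->
    tcone (val s) p = ray (direction r) (u s).
  by move=> /facet rs; exact: normal_tcone.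
have inr (s : cells_dim X d) : is_face r (val s) -> val s p.
  by move=> rs; apply: (face_subset rs).
have pr (s : cells_dim X d) : `[< is_face r (val s) >] -> primitive (direction r) (u s).
  by move=> /asboolP/facet rs; exact: normal_primitive.
have Lr (s : cells_dim X d) l : is_face r (val s) -> l \in direction r ->
    tcone (val s) p l.
  by move=> rs lr; rewrite tcn//; exists 0 => //; rewrite scale0r subr0.
have uinj (s t : cells_dim X d) : `[< is_face r (val s) >] ->
    `[< is_face r (val t) >] -> u s - u t \in direction r -> s = t.
  move=> rs rt st; apply: val_inj; have [uL _ _] := pr s rs.
  move: rs rt => /asboolP rs /asboolP rt.
  apply: (top_eq_cone pureX (valP s) (valP t) dr (inr s rs) (inr t rt) _ _ uL).
  - by move=> l; exact: Lr.
  - by move=> l; exact: Lr.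
  - by rewrite tcn//; exact: ray_self.
  - by rewrite tcn//; apply: ray_congr (ray_self _ _); rewrite -memvN opprB.
have ucov (t : cells_dim Y d) v : val t p -> tcone (val t) p v ->
    exists2 s : cells_dim X d, `[< is_face r (val s) >] & ray (direction r) (u s) v.
  move=> tp tv; have := top_germ_small tp tv.
  move=> /(smallW (fun e _ => @sYX _))/(germ_top pureX)[s [sX sp ts]].
  have [sX' _] := (iffLR (cells_dimP _ _ _) sX).
  have rs : is_face r s.
    by apply: (subset_face sX' rX); exact: (relint_subcell rX sX' ip sp).
  exists (Sub s sX); first exact/asboolP.
  by rewrite -tcn.
rewrite (eq_bigr (fun s : cells_dim X d => u s *~ local_weight Y p (u s))).
  exact: (local_balance dr LY pr uinj ucov).
move=> s rs; have [uL _ _] := pr s rs.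
move: rs => /asboolP rs; congr (_ *~ _).
apply: (transfer_local (inr s rs) dr _ LY uL).
  by move=> l; exact: Lr.
by rewrite tcn//; exact: ray_self.
Qed.

End Spread.

(** * The complex of intersections of cells *)

Section Refinement.
Variables (R : realType) (n : nat) (X Y : pcomplex R n).
Implicit Types (p q x v : 'rV[R]_n) (r s t : set 'rV[R]_n).

Definition meet_cells : {fset (set 'rV[R]_n)} :=
  [fset r in [fset (s `&` t)%classic | s in cells X, t in cells Y]
     | `[< r !=set0 >]]%fset.

Lemma meet_cellsP r : r \in meet_cells <->
  exists s t, [/\ s \in cells X, t \in cells Y, r = s `&` t & r !=set0].
Proof.
rewrite !inE /=; split.
  by move=> /andP[/imfset2P[s /= sX [t /= tY ->]] /asboolP r0]; exists s, t.
move=> [s [t [sX tY -> r0]]]; apply/andP; split; last exact/asboolP.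
by apply/imfset2P; exists s => //; exists t.
Qed.

Lemma meet_polyhedron r : r \in meet_cells -> rational_polyhedron r.
Proof.
move=> /meet_cellsP[s [t [sX tY -> _]]].
by apply: polyhedronI; [exact: (cells_polyhedron sX)|exact: (cells_polyhedron tY)].
Qed.

Lemma meet_neq0 r : r \in meet_cells -> r !=set0.
Proof. by move=> /meet_cellsP[s [t []]]. Qed.

(** Every face of the intersection is the minimal face of one of its points, and
    minimal faces commute with intersection. *)
Lemma meet_face r r' : r \in meet_cells -> is_face r' r -> r' \in meet_cells.
Proof.
move=> rZ fr; have [p r'p r'E] := polyhedron_face (meet_polyhedron rZ) fr.
have := face_subset fr r'p; move: rZ r'E.
move=> /meet_cellsP[s [t [sX tY -> _]]] r'E [sp tp].
apply/meet_cellsP; exists (min_face s p), (min_face t p).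
split; [exact: min_face_cell|exact: min_face_cell| |by exists p].
rewrite r'E mfaceI//; [exact: cells_convex sX|exact: cells_convex tY].
Qed.

(** Two forms that are minimal at a common point have a sum that is minimal
    exactly where both are. *)
Lemma minimal_locusD s t g h p : minimal_locus g s p -> minimal_locus h t p ->
  minimal_locus g s `&` minimal_locus h t = minimal_locus (g + h) (s `&` t).
Proof.
have lformDl (a b x : 'rV[R]_n) : lform (a + b) x = lform a x + lform b x.
  by rewrite /lform -big_split; apply: eq_bigr => i _; rewrite mxE mulrDl.
move=> [sp gp] [tp hp]; apply/seteqP; split=> x.
  by move=> [[sx gx] [tx hx]]; split=> // y [sy ty]; rewrite !lformDl lerD ?gx ?hx.
move=> [[sx tx] /(_ p (conj sp tp))]; rewrite !lformDl => le.
have gx := gp _ sx; have hx := hp _ tx.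
split; split=> // y sy.
  by apply: le_trans (gp _ sy); lra.
by apply: le_trans (hp _ sy); lra.
Qed.

Lemma meet_inter r r' : r \in meet_cells -> r' \in meet_cells ->
  (r `&` r') !=set0 -> is_face (r `&` r') r /\ is_face (r `&` r') r'.
Proof.
move=> /meet_cellsP[s [t [sX tY -> _]]] /meet_cellsP[s' [t' [s'X t'Y -> _]]].
rewrite setIACA => -[p [ssp ttp]].
have [|[_ [g gE]] [_ [g' g'E]]] := cells_inter sX s'X; first by exists p.
have [|[_ [h hE]] [_ [h' h'E]]] := cells_inter tY t'Y; first by exists p.
split; split; try by exists p.
  exists (g + h); rewrite gE hE; apply: minimal_locusD.
    by rewrite -gE; exact: ssp.
  by rewrite -hE; exact: ttp.
exists (g' + h'); rewrite g'E h'E; apply: minimal_locusD.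
  by rewrite -g'E; exact: ssp.
by rewrite -h'E; exact: ttp.
Qed.

Definition meet_complex : pcomplex R n :=
  PComplex meet_polyhedron meet_neq0 meet_face meet_inter.

Lemma support_meet : Defs.support meet_complex = Defs.support X `&` Defs.support Y.
Proof.
apply/seteqP; split=> x.
  by move=> [r /meet_cellsP[s [t [sX tY -> _]]] [sx tx]]; split; [exists s|exists t].
move=> [[s sX sx] [t tY tx]]; exists (s `&` t) => //.
by apply/meet_cellsP; exists s, t; split=> //; exists x.
Qed.

(** Let [p] be in the relative interior of a cell [r].  A maximal cell [t'] of [Y]
    through [p] contains points near [p] in general position; they lie in cells
    [s'] of [X] through [p] that meet [t'] in full dimension. *)
Lemma meet_pure d : pure d Y -> Defs.support Y `<=` Defs.support X ->
  pure d meet_complex.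
Proof.
move=> pY sYX.
have step r : r \in cells meet_complex -> exists2 r',
    r' \in cells_dim meet_complex d & is_face r r'.
  move=> rZ; have [s [t [sX tY rE r0]]] := (iffLR (meet_cellsP r) rZ).
  have [p ip] := relint_exists (meet_polyhedron rZ) r0.
  have [sp tp] : (s `&` t) p by rewrite -rE; case: ip.
  have [t' t'Y tt'] := pure_cell pY tY; have t'p := tt' _ tp.
  have [t'Y' dt'] := (iffLR (cells_dimP _ _ _) t'Y).
  have ct' := cells_convex t'Y'.
  have [x t'x sm] :=
    generic_near [seq s' `&` t' | s' <- enum_fset (cells X)] id ct' t'p.
  have [|s' [s'X s'p ts']] := @germ_cell _ _ X p (x - p).
    exists 1; first exact: ltr01.
    move=> e e0 e1; apply: sYX; exists t' => //.
    exact: (ct' _ _ e t'p t'x (ltW e0) e1).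
  have sm2 := tcone_small (cells_convex s'X) s'p ts'.
  have [e [e0 e1 [h1 h2]]] := small_ex ltr01 (smallI sm sm2).
  have dim : (d <= pdim (s' `&` t'))%N.
    rewrite -dt'; apply: h1; first by apply/mapP; exists s'.
    by split=> //; exact: (ct' _ _ e t'p t'x (ltW e0) e1).
  have r'Z : s' `&` t' \in cells meet_complex.
    by apply/meet_cellsP; exists s', t'; split=> //; exists p.
  exists (s' `&` t').
    apply/cells_dimP; split=> //; apply/eqP; rewrite eqn_leq dim andbT -dt'.
    by apply: pdimS; exact: subIsetr.
  by apply: (subset_face r'Z rZ); apply: (relint_subcell rZ r'Z ip).
split=> //; have [t /cells_dimP[tY _]] := pure_nonempty pY.
have [x tx] := cells_neq0 tY; have [s sX sx] : Defs.support X x by apply: sYX; exists t.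
exists (s `&` t); apply/meet_cellsP; exists s, t; split=> //; by exists x.
Qed.

End Refinement.

(** * Equivalence of weighted complexes *)

Section CycleEq.
Variables (R : realType) (n d : nat).
Implicit Types (X Y Z : wcomplex R n d).

Lemma refines_top Z X (z : cells_dim Z d) (s : cells_dim X d) p : refines Z X ->
  val z p -> relint (val s) p -> wt Z z = wt X s.
Proof.
move=> [_ sub w] zp ip; apply: w; have [zZ _] := top_val z.
have [s1 s1X zs1] := sub _ zZ; have [s2 s2X s12] := pure_cell (wcx_pure X) s1X.
have [s2X' _] := (iffLR (cells_dimP _ _ _) s2X).
rewrite (relint_top_eq (wcx_pure X) (valP s) s2X' ip); last exact/s12/zs1.
exact: subset_trans zs1 s12.
Qed.

(** Equivalence means equality of weights on the overlaps of maximal cells.  Given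
    a common refinement, a general point of an overlap lies in one of its maximal
    cells.  Conversely the intersections of cells form a common refinement. *)
Lemma cycle_eqP X Y : cycle_eq X Y <-> Defs.support X = Defs.support Y /\
  forall (s : cells_dim X d) (t : cells_dim Y d), overlap d (val s) (val t) ->
    wt X s = wt Y t.
Proof.
split=> [[sXY [Z [ZX ZY]]]|[sXY wXY]].
  split=> // s t [st0 dst]; have [sX ds] := top_val s; have [tY dt] := top_val t.
  have cst : convex (val s `&` val t).
    by apply: convexI; [exact: cells_convex sX|exact: cells_convex tY].
  have [p [sp tp] h] := generic_point (enum_fset (cells X) ++ enum_fset (cells Y)
    ++ enum_fset (cells Z)) id cst st0.
  have {}h D : D \in enum_fset (cells X) ++ enum_fset (cells Y)
      ++ enum_fset (cells Z) -> D p -> (d <= pdim D)%N.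
    by move=> Dl Dp; apply: leq_trans dst _; exact: h.
  have ips : relint (val s) p.
    apply: (relint_of_dim sX sp) => r rX rp; rewrite ds; apply: h => //.
    by rewrite mem_cat rX.
  have ipt : relint (val t) p.
    apply: (relint_of_dim tY tp) => r rX rp; rewrite dt; apply: h => //.
    by rewrite !mem_cat rX orbT.
  have [z zZ zp] : Defs.support Z p by case: ZX => -> _ _; exists (val s).
  have zd : z \in cells_dim Z d.
    apply/cells_dimP; split=> //; apply/eqP; rewrite eqn_leq h ?andbT//.
      exact: (pure_dim_le (wcx_pure Z)).
    by rewrite !mem_cat zZ !orbT.
  rewrite -(refines_top (z := Sub z zd) ZX zp ips).
  by rewrite -(refines_top (z := Sub z zd) ZY zp ipt).
split=> //.
have pZ : pure d (meet_complex X Y).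
  by apply: meet_pure; [exact: wcx_pure|rewrite sXY].
pose w : {ffun cells_dim (meet_complex X Y) d -> int} :=
  [ffun z => if [pick t : cells_dim Y d | `[< val z `<=` val t >]] is Some t
             then wt Y t else 0].
have sub z : z \in cells (meet_complex X Y) ->
    (exists2 s, s \in cells X & z `<=` s) /\ (exists2 t, t \in cells Y & z `<=` t).
  move=> /meet_cellsP[s [t [sX tY -> _]]].
  by split; [exists s => //; exact: subIsetl|exists t => //; exact: subIsetr].
have ov (z : cells_dim (meet_complex X Y) d) C D : val z `<=` C -> val z `<=` D ->
    overlap d C D.
  move=> zC zD; have [zZ dz] := top_val z.
  have zCD : val z `<=` C `&` D by move=> x zx; split; [exact: zC|exact: zD].
  split; last by rewrite -{1}dz; exact: pdimS.
  by have [x zx] := cells_neq0 zZ; exists x; exact: zCD.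
have wE (z : cells_dim (meet_complex X Y) d) (t : cells_dim Y d) :
    val z `<=` val t -> w z = wt Y t.
  move=> zt; rewrite ffunE; case: pickP => [t' /asboolP zt'|/(_ t)/asboolP//].
  congr (wt Y _); apply: val_inj; have [tY _] := top_val t.
  have [tt0 dtt] := ov z _ _ zt' zt.
  exact: (top_eq (wcx_pure Y) (valP t') tY).
exists (WComplex pZ w); split; split.
- by rewrite support_meet sXY setIid.
- by move=> z /sub[].
- move=> z s zs; have [zZ _] := top_val z; have [_ [t1 t1Y zt1]] := sub _ zZ.
  have [t2 t2Y t12] := pure_cell (wcx_pure Y) t1Y.
  have zt2 : val z `<=` val (Sub t2 t2Y : cells_dim Y d) by exact: subset_trans zt1 t12.
  by rewrite [wt _ _](wE z _ zt2); apply/esym/wXY; exact: (ov z).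
- by rewrite support_meet sXY setIid.
- by move=> z /sub[].
- by move=> z t zt; exact: wE.
Qed.

Lemma overlap_self (X : pcomplex R n) (s : cells_dim X d) : overlap d (val s) (val s).
Proof.
have [sX ds] := top_val s; rewrite /overlap setIid; split; last by rewrite ds.
exact: (cells_neq0 sX).
Qed.

(** A general point of [t] lies on a cell that meets [t] in full dimension. *)
Lemma overlap_exists (X : pcomplex R n) (t : set 'rV[R]_n) : pure d X ->
  convex t -> t !=set0 -> pdim t = d -> t `<=` Defs.support X ->
  exists s : cells_dim X d, overlap d (val s) t.
Proof.
move=> pX ct t0 dt tX.
have [p tp h] := generic_point [seq s `&` t | s <- enum_fset (cells X)] id ct t0.
have [s sX sp] := tX p tp.
have dim : (d <= pdim (s `&` t))%N.
  by rewrite -{1}dt; apply: h; [apply/mapP; exists s|split].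
have sd : s \in cells_dim X d.
  apply/cells_dimP; split=> //; apply/eqP; rewrite eqn_leq (pure_dim_le pX sX)/=.
  by apply: leq_trans dim _; apply: pdimS; exact: subIsetl.
by exists (Sub s sd); split=> //; exists p.
Qed.

End CycleEq.

(** * Irreducibility and the weight space *)

Section Main.
Variables (R : realType) (n d : nat).

(** The factor [m] covers the division of a weight by a common divisor. *)
Lemma balanced_lin (X : pcomplex R n) (w1 w2 w : weight d X) (k m : int) :
  m != 0 -> (forall s, m * w s = w1 s + k * w2 s) ->
  balanced w1 -> balanced w2 -> balanced w.
Proof.
move=> m0 wE b1 b2 t tX dt.
have mR : (m%:~R : R) != 0 by rewrite intr_eq0.
rewrite -[X in X \in _](scalerK mR) memvZ//.
have -> : m%:~R *: (\sum_(s : cells_dim X d | `[< is_face t (val s) >])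
      lattice_normal (val s) t *~ w s) =
    \sum_(s : cells_dim X d | `[< is_face t (val s) >])
      lattice_normal (val s) t *~ w1 s +
    k%:~R *: (\sum_(s : cells_dim X d | `[< is_face t (val s) >])
      lattice_normal (val s) t *~ w2 s).
  rewrite !scaler_sumr -big_split; apply: eq_bigr => s _ /=.
  by rewrite !scaler_int -!mulrzA ![w _ * _]mulrC ![w2 _ * _]mulrC wE mulrzDr.
by rewrite memvD ?memvZ//; [exact: b1|exact: b2].
Qed.

Variable X : tropical_cycle R n d.

(** On a fixed complex every maximal cell overlaps itself, so that equivalent
    weights are equal. *)
Lemma irreducible_proportional (w : weight d X) : irreducible_cycle X ->
  (forall s, w s != 0) -> balanced w -> exists k : int, forall s, w s = k * wt X s.
Proof.
move=> irr w0 bw.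
pose Y := @TropicalCycle _ _ _ (WComplex (wcx_pure X) w) w0 bw.
have [//|k /cycle_eqP[_ h]] := irr Y.
exists k => s; rewrite (h s s (overlap_self s)).
by rewrite ffunE.
Qed.

Definition real_weight (w : weight d X) : {ffun cells_dim X d -> R^o} :=
  [ffun s => (w s)%:~R : R^o].

Lemma mem_weight_space w : balanced w -> real_weight w \in weight_space d X.
Proof. by move=> bw; apply: mem_lspan; exists w. Qed.

Lemma real_weight_neq0 : real_weight (wt X) != 0.
Proof.
have [s sX] := pure_nonempty (wcx_pure X).
apply/eqP => /ffunP/(_ (Sub s sX)); rewrite !ffunE => /eqP.
by rewrite intr_eq0 (negPf (tc_neq0 _)).
Qed.

Lemma weight_gcd_dvd s : (weight_gcd X %| wt X s)%Z.
Proof.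
rewrite /weight_gcd; elim: index_enum (mem_index_enum s) => // a l IH.
rewrite inE big_cons => /orP[/eqP ->|/IH]; first exact: dvdz_gcdl.
exact/dvdz_trans/dvdz_gcdr.
Qed.

Lemma weight_gcd_ge0 : 0 <= weight_gcd X.
Proof. by rewrite /weight_gcd; elim/big_rec: _. Qed.

Lemma dvd_weight_gcd a m : (forall s, (m %| a * wt X s)%Z) -> (m %| a * weight_gcd X)%Z.
Proof.
move=> h; rewrite /weight_gcd.
apply: (big_ind (fun g => (m %| a * g)%Z)) => [|x y hx hy|//].
  by rewrite mulr0 dvdz0.
have : (m %| (`|a|%N)%:Z * gcdz x y)%Z by rewrite mulz_gcdr dvdz_gcd hx.
by rewrite !dvdzE !abszM absz_nat.
Qed.

(** [wt X] divided by its gcd [g] is again a cycle, hence equal to [k * wt X] for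
    some integer [k], and [k * g = 1]. *)
Lemma irreducible_gcd : irreducible_cycle X -> weight_gcd X = 1.
Proof.
move=> irr; set g := weight_gcd X.
have [s sX] := pure_nonempty (wcx_pure X); pose s0 : cells_dim X d := Sub s sX.
have gw s' : wt X s' = g * (wt X s' %/ g)%Z by rewrite mulrC divzK ?weight_gcd_dvd.
have g0 : g != 0.
  by have := tc_neq0 s0; rewrite gw; apply: contra => /eqP ->; rewrite mul0r.
pose w : weight d X := [ffun s => (wt X s %/ g)%Z].
have w0 s' : w s' != 0.
  by have := tc_neq0 s'; rewrite gw ffunE; apply: contra => /eqP ->; rewrite mulr0.
have bw : balanced w.
  apply: (balanced_lin (k := 0) g0 _ (@tc_balanced _ _ _ X) (@tc_balanced _ _ _ X)).
  by move=> s'; rewrite ffunE -gw mul0r addr0.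
have [k /(_ s0)] := irreducible_proportional irr w0 bw.
rewrite gw mulrA ffunE -{1}[(_ %/ _)%Z]mul1r.
have wn0 : (wt X s0 %/ g)%Z != 0 by have := w0 s0; rewrite ffunE.
move=> /(mulIf wn0) e; have : `|g|%N = 1%N.
  have : (`|k| * `|g| = 1)%N by rewrite -abszM -e.
  by move=> /eqP; rewrite muln_eq1 => /andP[_ /eqP].
by have := weight_gcd_ge0; rewrite -/g; lia.
Qed.

(** Adding a large multiple of [wt X] makes a balanced weight vanish nowhere,
    because [wt X] does not vanish. *)
Lemma irreducible_dim : irreducible_cycle X -> \dim (weight_space d X) = 1%N.
Proof.
move=> irr; suff -> : weight_space d X = <[real_weight (wt X)]>%VS.
  by rewrite dim_vline real_weight_neq0.
apply/eqP; rewrite eqEsubv -memvE mem_weight_space ?andbT; last exact: tc_balanced.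
apply: lspan_sub => _ [w bw ->].
(* Large enough for [m * wt X s] to dominate [w s] in every cell. *)
pose m : int := 1 + \sum_s `|w s|.
have le_m s : `|w s| < m.
  by rewrite /m (bigD1 s)//= ltz1D lerDl sumr_ge0.
pose w' : weight d X := [ffun s => w s + m * wt X s].
have w'0 s : w' s != 0.
  rewrite ffunE; apply/eqP => /eqP; rewrite addr_eq0 => /eqP e.
  have := le_m s; rewrite e normrN normrM ltNge => /negP; apply.
  have m0 : 0 <= m by apply: le_trans (ltW (le_m s)).
  rewrite (ger0_norm m0) ler_peMr//.
  by have := tc_neq0 s; lia.
have bw' : balanced w'.
  apply: (balanced_lin (oner_neq0 _) _ bw (@tc_balanced _ _ _ X)).
  by move=> s; rewrite ffunE mul1r; reflexivity.
have [k wk] := irreducible_proportional irr w'0 bw'.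
apply/vlineP; exists (k - m)%:~R; apply/ffunP => s; rewrite !ffunE.
have -> : w s = (k - m) * wt X s.
  by have := wk s; rewrite ffunE mulrBl => <-; rewrite addrK.
by rewrite intrM.
Qed.

(** The real proportionality factor is the quotient of [f s0] by [wt X s0] for a
    maximal cell [s0]; it is an integer since [wt X s0] divides [f s0 * wt X s] for
    every [s], hence divides [f s0] times the gcd. *)
Lemma dim1_proportional (f : weight d X) : weight_gcd X = 1 ->
  \dim (weight_space d X) = 1%N -> balanced f ->
  exists k : int, forall s, f s = k * wt X s.
Proof.
move=> g1 dim1 bf.
have VE : <[real_weight (wt X)]>%VS = weight_space d X.
  apply/eqP; rewrite eqEdim dim1 dim_vline real_weight_neq0 leqnn andbT -memvE.
  exact/mem_weight_space/tc_balanced.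
have [c cE] : exists c, real_weight f = c *: real_weight (wt X).
  by apply/vlineP; rewrite VE mem_weight_space.
have {}cE s : ((f s)%:~R : R) = c * (wt X s)%:~R.
  by have /ffunP/(_ s) := cE; rewrite !ffunE.
have [s1 s1X] := pure_nonempty (wcx_pure X); pose s0 : cells_dim X d := Sub s1 s1X.
have cross s : f s * wt X s0 = f s0 * wt X s.
  by apply: (@intr_inj R); rewrite !intrM !cE mulrAC.
have : (wt X s0 %| f s0 * weight_gcd X)%Z.
  by apply: dvd_weight_gcd => s; rewrite -cross dvdz_mull.
rewrite g1 mulr1 => /dvdzP[k kE]; exists k => s.
by apply: (mulIf (tc_neq0 s0)); rewrite cross kE mulrAC.
Qed.

Lemma dim1_irreducible : weight_gcd X = 1 -> \dim (weight_space d X) = 1%N ->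
  irreducible_cycle X.
Proof.
move=> g1 dim1 Y sYX; have pX := wcx_pure X.
have [k kE] := dim1_proportional g1 dim1 (transfer_balanced pX sYX).
exists k; apply/cycle_eqP.
have ovsym (C D : set 'rV[R]_n) : overlap d C D -> overlap d D C.
  by rewrite /overlap setIC.
split; last first.
  move=> t s /ovsym st; rewrite -(transferE pX sYX (s := s) (t := t) st) kE.
  by rewrite /= ffunE.
have [t tYd] := pure_nonempty (wcx_pure Y).
have [tY dt] := (iffLR (cells_dimP _ _ _) tYd).
have [|s st] := overlap_exists pX (cells_convex tY) (cells_neq0 tY) dt.
  by move=> x tx; apply: sYX; exists t.
have k0 : k != 0.
  have := kE s; rewrite (transferE pX sYX (t := Sub t tYd) st) => e.
  have := tc_neq0 (Sub t tYd : cells_dim Y d); rewrite e; apply: contra.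
  by move=> /eqP ->; rewrite mul0r.
apply/seteqP; split=> // x [s1 s1X s1x].
have [s2 s2X s12] := pure_cell pX s1X.
have : transfer X Y (Sub s2 s2X) != 0 by rewrite kE mulf_neq0 ?tc_neq0.
rewrite ffunE; case: pickP => [t' /asboolP ov _|_]; last by rewrite eqxx.
exact: (overlap_covered pX sYX s2X ov (s12 _ s1x)).
Qed.

End Main.

Theorem theorem3p16 (R : realType) (n d : nat) (X : tropical_cycle R n d) :
  irreducible_cycle X <->
  weight_gcd X = 1 /\ \dim (weight_space d X) = 1%N.
Proof.
split=> [irr|[g1 dim1]]; last exact: dim1_irreducible.
by split; [exact: irreducible_gcd|exact: irreducible_dim].
Qed.
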